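(* Fix integers $r,s\ge1$ and put $\gamma:=r/(r+s)$. Let $p_0,p_1,p_2,p_3\in[0,1]$ be such that $0<p_m<1$ for $m=0,1,2$ or $0<p_m<1$ for $m=1,2,3$. If $$ \max\Big[\big|\tfrac{\gamma}{2}+(1-\gamma)(p_0-p_1)\big|,\ \big|\tfrac{\gamma}{2}+(1-\gamma)(p_2-p_3)\big|\Big]+\max\Big[\big|\tfrac{\gamma}{2}+(1-\gamma)(p_0-p_2)\big|,\ \big|\tfrac{\gamma}{2}+(1-\gamma)(p_1-p_3)\big|\Big]<1, $$ then $\lim_{N\to\infty}\mu_{(\gamma,1-\gamma)'}^N$ exists, and $\lim_{N\to\infty}\mu_{[r,s]'}^N=\lim_{N\to\infty}\mu_{(\gamma,1-\gamma)'}^N$.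
   Context: For $N\ge3$ players labeled $1,\dots,N$ in a circle (labels mod $N$, so $0$ means $N$ and $N+1$ means $1$), the state space is $\{0,1\}^N$. For $\eta\in\{0,1\}^N$ let $m_x(\eta):=2\eta(x-1)+\eta(x+1)\in\{0,1,2,3\}$, let $\eta_x$ be $\eta$ with the $x$th coordinate flipped ($\eta(x)$ replaced by $1-\eta(x)$), and let $q_m:=1-p_m$. Game $B$: the transition matrix $P_B$ on $\{0,1\}^N$ is $P_B(\eta,\eta_x)=N^{-1}p_{m_x(\eta)}$ if $\eta(x)=0$, $P_B(\eta,\eta_x)=N^{-1}q_{m_x(\eta)}$ if $\eta(x)=1$ ($x=1,\dots,N$), $P_B(\eta,\eta)=N^{-1}\big(\sum_{x:\eta(x)=0}q_{m_x(\eta)}+\sum_{x:\eta(x)=1}p_{m_x(\eta)}\big)$, all other entries being $0$. Signed version $\dot P_B$ (each $q_m$ replaced by $-q_m$): $\dot P_B(\eta,\eta_x)=N^{-1}p_{m_x(\eta)}$ if $\eta(x)=0$, $\dot P_B(\eta,\eta_x)=-N^{-1}q_{m_x(\eta)}$ if $\eta(x)=1$, $\dot P_B(\eta,\eta)=N^{-1}\big(-\sum_{x:\eta(x)=0}q_{m_x(\eta)}+\sum_{x:\eta(x)=1}p_{m_x(\eta)}\big)$, all other entries $0$. Game $A'$: a uniformly random player $x$ picks one of the two neighbors $x-1$, $x+1$ with probability $1/2$ each, and a fair coin decides which of the two wins; the winner's status becomes $1$ and the loser's becomes $0$. Thus, writing $\eta^{x,y,1}$ (resp. $\eta^{x,y,-1}$)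 for $\eta$ with $\eta(x)$ set to $1$ and $\eta(y)$ set to $0$ (resp. $\eta(x)$ set to $0$ and $\eta(y)$ set to $1$), $P_{A'}(\eta,\zeta)=\frac{1}{4N}\,\#\{(x,y,\epsilon): 1\le x\le N,\ y\in\{x-1,x+1\},\ \epsilon\in\{-1,1\},\ \eta^{x,y,\epsilon}=\zeta\}$. With $\mathbf 1$ the column vector of ones, the means for $N$ players are $$\mu^N_{(\gamma,1-\gamma)'}:=(1-\gamma)\,\pi_{C'}\dot P_B\mathbf 1,\qquad \mu^N_{[r,s]'}:=\frac1{r+s}\sum_{v=0}^{s-1}\pi P_{A'}^rP_B^v\dot P_B\mathbf 1,$$ where the row vector $\pi_{C'}$ is the unique stationary distribution of $\gamma P_{A'}+(1-\gamma)P_B$ and the row vector $\pi$ is the unique stationary distribution of $P_{A'}^rP_B^s$ (all depending on $N$). *)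

(* Defs.v *)
From HB Require Import structures.
From mathcomp Require Import all_boot all_order all_algebra.
From mathcomp Require Import all_classical all_reals all_analysis.
Import Order.TTheory GRing.Theory Num.Theory.
Import numFieldNormedType.Exports.

Set Implicit Arguments.
Unset Strict Implicit.
Unset Printing Implicit Defensive.

Local Open Scope classical_set_scope.
Local Open Scope ring_scope.

(** The players 1, ..., N are represented by 'I_N (so player N is 0 or, by
    rotation invariance, any other fixed label); [ord_pred] and [ordS] are the
    cyclic predecessor and successor.  All definitions make sense for every
    [N : nat] but model the games only for [3 <= N]; the values at
    [N = 0, 1, 2] are irrelevant for limits as [N] tends to infinity. *)
Notation state N := {ffun 'I_N -> bool}.

Section Games.
Variables (R : realType) (N : nat).
Implicit Types (eta zeta : state N) (x y z : 'I_N) (p q : nat -> R).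

Definition nbr_code eta x : nat := (2 * eta (ord_pred x) + eta (ordS x))%N.

Definition flip eta x : state N :=
  [ffun z => if z == x then ~~ eta z else eta z].

(** The outcome of a round between [x] and [y], won by [x] if [b] and by [y]
    otherwise. *)
Definition duel eta x y (b : bool) : state N :=
  [ffun z => if z == x then b else if z == y then ~~ b else eta z].

(** Square matrices indexed by the states, through the enumeration of the
    finite type [state N]. *)
Definition state_mx (K : state N -> state N -> R) : 'M[R]_#|state N| :=
  \matrix_(i, j) K (enum_val i) (enum_val j).

(** The entries of the matrix of game B, for arbitrary [q]: the stochastic
    matrix is obtained for [q m = 1 - p m], its signed version for
    [q m = - (1 - p m)].  The states [flip eta x] are pairwise distinct and
    differ from [eta], so the sum in the last branch has at most one term. *)
Definition kernelB p q eta zeta : R :=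
  if zeta == eta then
    N%:R^-1 * (\sum_(x | ~~ eta x) q (nbr_code eta x)
               + \sum_(x | eta x) p (nbr_code eta x))
  else
    \sum_(x | zeta == flip eta x)
      N%:R^-1 * (if eta x then q (nbr_code eta x) else p (nbr_code eta x)).

Definition kernelA' eta zeta : R :=
  (4 * N)%:R^-1 *
  #|[set t : 'I_N * 'I_N * bool |
      let: (x, y, b) := t in
      (y \in [:: ord_pred x; ordS x]) && (duel eta x y b == zeta)]%SET|%:R.

Definition PA' : 'M[R]_#|state N| := state_mx kernelA'.

Definition PB (p : 4.-tuple R) : 'M[R]_#|state N| :=
  state_mx (kernelB (fun m => p`_m) (fun m => 1 - p`_m)).

Definition PBdot (p : 4.-tuple R) : 'M[R]_#|state N| :=
  state_mx (kernelB (fun m => p`_m) (fun m => - (1 - p`_m))).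

End Games.

Section Stationary.
Variables (R : realType) (n : nat).

Definition is_stationary (P : 'M[R]_n) (pi : 'rV[R]_n) : Prop :=
  [/\ forall j, 0 <= pi ord0 j, \sum_j pi ord0 j = 1 & pi *m P = pi].

(** The stationary distribution of [P] when it is unique.  A stochastic matrix
    of positive size always has one, so the default value 0 is not used for the
    chains below.  For these chains uniqueness holds when [3 <= N], [1 <= r],
    [1 <= s], [0 < gamma < 1] and [p`_m] lies in ]0, 1[ for m = 0, 1, 2 (resp.
    m = 1, 2, 3): the state with all coordinates 0 (resp. 1) can be reached
    from every state. *)
Definition stationary (P : 'M[R]_n) : 'rV[R]_n :=
  xget 0 [set pi | is_stationary P pi].

End Stationary.

Section Means.
Variables (R : realType).

Definition mu_mix (gamma : R) (p : 4.-tuple R) (N : nat) : R :=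
  let piC := stationary (gamma *: PA' R N + (1 - gamma) *: PB N p) in
  (1 - gamma) * (piC *m PBdot N p *m (const_mx 1 : 'cV_#|state N|)) ord0 ord0.

Definition mu_pat (r s : nat) (p : 4.-tuple R) (N : nat) : R :=
  let pi := stationary (PA' R N ^+ r *m PB N p ^+ s) in
  (r + s)%:R^-1 *
  \sum_(0 <= v < s)
    (pi *m PA' R N ^+ r *m PB N p ^+ v *m PBdot N p
        *m (const_mx 1 : 'cV_#|state N|)) ord0 ord0.

End Means.

(* Main.v *)
Require Import Defs.
From mathcomp Require Import all_boot all_order all_algebra.
From mathcomp Require Import all_classical all_reals all_analysis.
From mathcomp Require Import ring lra zify.
Import Order.TTheory GRing.Theory Num.Theory.
Import numFieldNormedType.Exports.
Local Open Scope classical_set_scope.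
Local Open Scope ring_scope.

Set Implicit Arguments.
Unset Strict Implicit.
Unset Printing Implicit Defensive.

(** A round of either game is the average over the sites [x] of a local update,
    so [N (P - 1)] is a bounded-rate generator.  In each round, the oscillation
    of an observable in the coordinate [y] is killed by game B when [y] plays,
    and by game A' when one of the two edges at [y] is drawn; game B moves it to
    the neighbours of [y] with weights [c] (right) and [a] (left), the largest
    influences of a neighbour on the win probability.  The hypothesis implies
    [(1 - gamma) (a + c) < 1 + gamma], so that on the circle of odd length
    [M = 2 K + 1] the Poisson equation [M (f - P f) = g - k], where [g] is the
    expected gain at the centre, has a solution whose oscillation at distance
    [d] from the centre is at most of order [rho ^ d], with [rho < 1]
    independent of [M].

    View [f] as an observable of a window of [M] sites in the circle of length
    [N > M].  There [N (P f - f)] differs from [k - g] only by terms coming from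
    the ends of the window, which are of order [rho ^ K].  Integrating against
    any stationary law of the mixture shows that the expected gain at every site
    is [k + O(rho ^ K)].  For the pattern, the product of the [r + s]
    one-round operators minus 1 is the sum of the generators up to [O(1 / N^2)]
    on the fixed local observable [f], so the same holds with an
    additional error [O_K(1 / N)].  Thus both means are Cauchy with the same
    limit. *)

(** * Cyclic arithmetic and site updates *)

Lemma val_ordS (n : nat) (x : 'I_n) : val (ordS x) = (x.+1 %% n)%N.
Proof. by []. Qed.

Lemma val_iter_ordS (n j : nat) (x : 'I_n) :
  val (iter j (@ordS n) x) = ((x + j) %% n)%N.
Proof.
elim: j => [|j IHj] /=; first by rewrite addn0 modn_small.
by rewrite IHj -addn1 modnDml addn1 addnS.
Qed.

Lemma ordS_neq (n : nat) (x : 'I_n) : (1 < n)%N -> ordS x != x.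
Proof.
move=> n1; apply/eqP => /(congr1 val); rewrite val_ordS.
have [lt_xn|] := ltnP x.+1 n; first by rewrite modn_small //=; lia.
move=> le_n; have -> : x.+1 = n by have := ltn_ord x; lia.
by rewrite modnn => x0; move: le_n; rewrite -x0; lia.
Qed.

Lemma ordS2_neq (n : nat) (x : 'I_n) : (2 < n)%N -> ordS (ordS x) != x.
Proof.
move=> n2; apply/eqP => /(congr1 val).
rewrite -[ordS (ordS x)]/(iter 2 (@ordS n) x) val_iter_ordS.
have ltxn := ltn_ord x.
have [lt_xn|le_n] := ltnP (x + 2) n; first by rewrite modn_small //=; lia.
have -> : (x + 2 = (x + 2 - n) + n)%N by lia.
by rewrite modnDr modn_small /=; lia.
Qed.

Lemma ord_pred_eq (n : nat) (x y : 'I_n) : (ord_pred x == y) = (x == ordS y).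
Proof. by apply/eqP/eqP => [<-|->]; rewrite ?ord_predK ?ordSK. Qed.

Lemma ordS_eq (n : nat) (x y : 'I_n) : (ordS x == y) = (x == ord_pred y).
Proof. by apply/eqP/eqP => [<-|->]; rewrite ?ord_predK ?ordSK. Qed.

Lemma ord_pred_neq (n : nat) (x : 'I_n) : (1 < n)%N -> ord_pred x != x.
Proof. by move=> n1; rewrite ord_pred_eq eq_sym ordS_neq. Qed.

Lemma ord_pred_neqS (n : nat) (x : 'I_n) : (2 < n)%N -> ord_pred x != ordS x.
Proof. by move=> n2; rewrite ord_pred_eq eq_sym ordS2_neq. Qed.

Definition upd (N : nat) (eta : state N) (x : 'I_N) (b : bool) : state N :=
  [ffun z => if z == x then b else eta z].

Section Updates.
Variable N : nat.
Implicit Types (eta : state N) (x y : 'I_N).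

Lemma upd_neq eta x b y : y != x -> upd eta x b y = eta y.
Proof. by move=> /negbTE yx; rewrite ffunE yx. Qed.

Lemma upd_id eta x : upd eta x (eta x) = eta.
Proof. by apply/ffunP => z; rewrite ffunE; case: eqP => [->|]. Qed.

Lemma upd_upd eta x b c : upd (upd eta x b) x c = upd eta x c.
Proof. by apply/ffunP => z; rewrite !ffunE; case: eqP. Qed.

Lemma updC eta x y b c : x != y -> upd (upd eta x b) y c = upd (upd eta y c) x b.
Proof.
by move=> /eqP xy; apply/ffunP => z; rewrite !ffunE; do 2 case: eqP => //; congruence.
Qed.

Lemma flipE eta x : flip eta x = upd eta x (~~ eta x).
Proof. by apply/ffunP => z; rewrite !ffunE; case: eqP => [->|]. Qed.

Lemma duelE eta x y b : duel eta x y b = upd (upd eta y (~~ b)) x b.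
Proof. by apply/ffunP => z; rewrite !ffunE. Qed.

Lemma duelC eta x y b : x != y -> duel eta x y b = duel eta y x (~~ b).
Proof. by move=> xy; rewrite !duelE negbK updC// eq_sym. Qed.

Lemma flip_neq eta x : flip eta x != eta.
Proof.
by apply/eqP => /ffunP/(_ x); rewrite ffunE eqxx; case: (eta x).
Qed.

End Updates.

(** * The games as operators on observables *)

Section Operators.
Variables (R : realType) (N : nat) (p : 4.-tuple R).
Implicit Types (f g : state N -> R) (eta zeta : state N).

(* Game A' as a dynamics on edges: the pair [{x, x + 1}] is drawn with
   probability [1 / N] and its statuses become (1, 0) or (0, 1), each with
   probability [1 / 2]. *)
Definition siteA f eta (x : 'I_N) : R :=
  2^-1 * (f (duel eta x (ordS x) true) + f (duel eta x (ordS x) false)).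

(** Heat-bath form of game B: whatever the present status of [x], the new one is 1 with the
    probability selected by its neighbours. *)
Definition siteB f eta (x : 'I_N) : R :=
  p`_(nbr_code eta x) * f (upd eta x true)
  + (1 - p`_(nbr_code eta x)) * f (upd eta x false).

Definition opA f eta : R := N%:R^-1 * \sum_x siteA f eta x.

Definition opB f eta : R := N%:R^-1 * \sum_x siteB f eta x.

(** Expected gain [p - (1 - p)] of player [x] in one round of game B, given that [x] plays. *)
Definition drift eta (x : 'I_N) : R := 2 * p`_(nbr_code eta x) - 1.

Definition mean_drift eta : R := N%:R^-1 * \sum_x drift eta x.

Definition fcol f : 'cV[R]_#|state N| := \col_i f (enum_val i).

Definition expect (nu : 'rV[R]_#|state N|) f : R :=
  \sum_i nu ord0 i * f (enum_val i).

Lemma expectE nu f : (nu *m fcol f) ord0 ord0 = expect nu f.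
Proof. by rewrite mxE; apply: eq_bigr => i _; rewrite mxE. Qed.

Lemma state_mx_fcol K f :
  state_mx K *m fcol f = fcol (fun eta => \sum_zeta K eta zeta * f zeta).
Proof.
apply/colP => i; rewrite !mxE (reindex (@enum_val _ (mem (state N)))) /=.
  by apply: eq_big => [j|j _]; rewrite ?enum_valP ?mxE.
by apply: onW_bij; apply: enum_val_bij.
Qed.

(** With [q] arbitrary, one computation serves both the stochastic matrix and its signed version. *)
Lemma kernelB_sum (q : nat -> R) f eta :
  \sum_zeta kernelB (fun m => p`_m) q eta zeta * f zeta =
  N%:R^-1 * \sum_x
    (if eta x then q (nbr_code eta x) * f (upd eta x false)
                   + p`_(nbr_code eta x) * f eta
     else p`_(nbr_code eta x) * f (upd eta x true) + q (nbr_code eta x) * f eta).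
Proof.
set w := fun x => N%:R^-1 * (if eta x then q (nbr_code eta x) else p`_(nbr_code eta x)).
rewrite (bigD1 eta) //= {1}/kernelB eqxx.
(* The off-diagonal sum is regrouped by the flipped site; a flip never returns [eta], so excluding
   the diagonal loses nothing. *)
have -> : \sum_(zeta | zeta != eta) kernelB (fun m => p`_m) q eta zeta * f zeta =
          \sum_x w x * f (flip eta x).
  under eq_bigr => zeta /negbTE zn.
    rewrite /kernelB zn mulr_suml.
    over.
  rewrite (exchange_big_dep xpredT) //=; apply: eq_bigr => x _.
  rewrite (big_pred1 (flip eta x)) // => zeta.
  by rewrite /= andbC; case: (eqVneq zeta (flip eta x)) => [->|_] //=; rewrite ?flip_neq.
rewrite -mulrA mulrDl !mulr_suml.
rewrite (big_mkcond (fun x => ~~ eta x)) (big_mkcond (fun x => eta x)).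
rewrite -big_split /= !mulr_sumr -big_split /=; apply: eq_bigr => x _.
rewrite /w flipE; case: (eta x) => /=; ring.
Qed.

Lemma PB_fcol f : PB N p *m fcol f = fcol (opB f).
Proof.
rewrite state_mx_fcol; congr fcol; apply: funext => eta.
rewrite kernelB_sum /opB; congr (_ * _); apply: eq_bigr => x _.
have := upd_id eta x; rewrite /siteB; case: (eta x) => ->; last by [].
by rewrite addrC.
Qed.

Lemma PBdot_fcol1 : PBdot N p *m const_mx 1 = fcol mean_drift.
Proof.
have -> : const_mx 1 = fcol (fun _ => 1) by apply/colP => i; rewrite !mxE.
rewrite state_mx_fcol; congr fcol; apply: funext => eta.
rewrite kernelB_sum /mean_drift; congr (_ * _); apply: eq_bigr => x _.
by rewrite /drift; case: ifP => _; ring.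
Qed.

(** Each edge is counted twice among the triples, once from either endpoint, which turns the weight
    [1 / (4 N)] into [1 / (2 N)] per edge and winner. For [2 < N] the two neighbours of a player are
    distinct. *)
Lemma PA_fcol f : (2 < N)%N -> PA' R N *m fcol f = fcol (opA f).
Proof.
move=> N2; rewrite state_mx_fcol; congr fcol; apply: funext => eta.
have N0 : N%:R != 0 :> R by rewrite pnatr_eq0; lia.
pose D := [pred t : 'I_N * 'I_N * bool | t.1.2 \in [:: ord_pred t.1.1; ordS t.1.1]].
have -> : \sum_zeta kernelA' R eta zeta * f zeta =
    (4 * N)%:R^-1 * \sum_(t | D t) f (duel eta t.1.1 t.1.2 t.2).
  rewrite (partition_big (fun t => duel eta t.1.1 t.1.2 t.2) xpredT) //= mulr_sumr.
  apply: eq_bigr => zeta _; rewrite /kernelA' -mulrA; congr (_ * _).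
  rewrite -sum1dep_card natr_sum mulr_suml.
  apply: eq_big => [[[x y] b]|[[x y] b]] //= /andP[_ /eqP ->].
  by rewrite mul1r.
have -> : \sum_(t | D t) f (duel eta t.1.1 t.1.2 t.2) =
    \sum_x \sum_b (f (duel eta x (ord_pred x) b) + f (duel eta x (ordS x) b)).
  under [RHS]eq_bigr => x _.
    have -> : \sum_b (f (duel eta x (ord_pred x) b) + f (duel eta x (ordS x) b)) =
       \sum_(y | y \in [:: ord_pred x; ordS x]) \sum_b f (duel eta x y b).
      rewrite (bigD1 (ord_pred x)) ?inE ?eqxx //= (big_pred1 (ordS x)) ?big_split // => y.
      rewrite !inE /=; case: (y =P ord_pred x) => [->|_] //=; last by rewrite andbT.
      by rewrite (negbTE (ord_pred_neqS _ _)).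
    over.
  rewrite pair_big_dep /= pair_big_dep /=.
  by apply: eq_bigl => [[[x y] b]] /=; rewrite andbT.
under eq_bigr do rewrite big_split.
(* Shifting [x] turns the duels with the left neighbour into duels on the edge from [x] to [ordS x],
   seen from its other endpoint. *)
rewrite big_split /= (reindex (@ordS N)) /=; last first.
  by exists (@ord_pred N) => x _; rewrite ?ordSK ?ord_predK.
rewrite -big_split /= /opA !mulr_sumr; apply: eq_bigr => x _.
rewrite ordSK !big_bool /= !(@duelC _ _ (ordS x)) ?ordS_neq //=; last lia.
  rewrite /siteA natrM; field.
  by rewrite N0.
lia.
Qed.

End Operators.

(** * Stationary distributions *)

(** [P - 1] kills the constant column, hence is singular and has a nonzero left kernel. *)
Lemma not_unitmx_fixed (F : fieldType) (n : nat) (P : 'M[F]_n) :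
  (0 < n)%N -> P *m const_mx 1 = const_mx 1 :> 'cV_n ->
  exists2 v : 'rV[F]_n, v != 0 & v *m P = v.
Proof.
move=> n0 P1; pose B := P - 1%:M.
have B1 : B *m const_mx 1 = 0 :> 'cV_n by rewrite mulmxBl P1 mul1mx subrr.
have : kermx B != 0.
  rewrite kermx_eq0 row_free_unit; apply/negP => uB.
  have /colP/(_ (Ordinal n0)) : const_mx 1 = 0 :> 'cV[F]_n.
    by rewrite -[LHS](mulKmx uB) B1 mulmx0.
  by rewrite !mxE => /eqP; rewrite oner_eq0.
case/rowV0Pn => v /sub_kermxP vB v0; exists v => //.
by apply/eqP; rewrite -subr_eq0 -[X in _ - X]mulmx1 -mulmxBr vB.
Qed.

(* For a fixed row vector [v] of a stochastic matrix, [|v|] is fixed too: it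
   is subinvariant entrywise, with the same total mass as its image. *)
Lemma stationaryP (R : realType) (n : nat) (P : 'M[R]_n) :
  (0 < n)%N -> (forall i j, 0 <= P i j) ->
  P *m const_mx 1 = const_mx 1 :> 'cV_n -> is_stationary P (stationary P).
Proof.
move=> n0 P_ge0 P1; suff [pi piP] : [set pi | is_stationary P pi] !=set0.
  exact: (xgetI 0 piP).
have [v v0 vP] := not_unitmx_fixed n0 P1.
pose t := \sum_j `|v ord0 j|.
have sumP i : \sum_j P i j = 1.
  have /colP/(_ i) := P1; rewrite !mxE => <-.
  by apply: eq_bigr => j _; rewrite mxE mulr1.
have sub j : 0 <= \sum_i `|v ord0 i| * P i j - `|v ord0 j|.
  rewrite subr_ge0 -{1}vP mxE (le_trans (ler_norm_sum _ _ _)) //.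
  by apply: ler_sum => i _; rewrite normrM (ger0_norm (P_ge0 _ _)).
have sum0 : \sum_j (\sum_i `|v ord0 i| * P i j - `|v ord0 j|) = 0.
  rewrite big_split sumrN /= exchange_big /=; apply/eqP.
  rewrite subr_eq0; apply/eqP; apply: eq_bigr => i _.
  by rewrite -mulr_sumr sumP mulr1.
have fix_abs j : \sum_i `|v ord0 i| * P i j = `|v ord0 j|.
  apply/eqP; rewrite -subr_eq0.
  have /eqP := sum0; rewrite psumr_eq0 // => /allP/(_ j).
  by rewrite mem_index_enum => /(_ isT).
have t0 : t != 0.
  apply: contra v0 => /eqP/eqP; rewrite psumr_eq0 // => /allP vz.
  apply/eqP/rowP => j; rewrite mxE; apply/eqP; rewrite -normr_eq0.
  by have := vz j; rewrite mem_index_enum => /(_ isT).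
exists (\row_j (`|v ord0 j| / t)); split => [j||].
- by rewrite mxE divr_ge0 // sumr_ge0.
- under eq_bigr do rewrite mxE; by rewrite -mulr_suml divff.
- apply/rowP => j; rewrite !mxE -fix_abs mulr_suml.
  by apply: eq_bigr => i _; rewrite mxE mulrAC.
Qed.

(** * Contraction of oscillations *)

Section Contraction.
Variables (R : realType) (N : nat) (p : 4.-tuple R).
Hypothesis N2 : (2 < N)%N.
Implicit Types (f g : state N -> R) (eta zeta : state N) (x y : 'I_N).

Lemma Ngt0 : 0 < N%:R :> R.
Proof. by rewrite ltr0n; lia. Qed.

Lemma siteA_le f c eta x : (forall zeta, `|f zeta| <= c) -> `|siteA f eta x| <= c.
Proof.
move=> fc; rewrite /siteA; have := fc (duel eta x (ordS x) true).
by have := fc (duel eta x (ordS x) false); rewrite !ler_norml; lra.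
Qed.

Lemma avg_le (F : 'I_N -> R) c : (forall x, `|F x| <= c) -> `|N%:R^-1 * \sum_x F x| <= c.
Proof.
move=> Fc; rewrite normrM ger0_norm ?invr_ge0 ?ler0n // ler_pdivrMl ?Ngt0 //.
rewrite (le_trans (ler_norm_sum _ _ _)) // (le_trans (ler_sum _ (fun x _ => Fc x))) //.
by rewrite sumr_const card_ord mulr_natl.
Qed.

Lemma opA_le f c eta : (forall zeta, `|f zeta| <= c) -> `|opA f eta| <= c.
Proof. by move=> fc; apply: avg_le => x; apply: siteA_le. Qed.

(** [D] is any profile of upper bounds rather than the exact oscillations, so that geometric
    profiles can be used directly. *)
Definition osc f (D : 'I_N -> R) :=
  forall eta y b, `|f (upd eta y b) - f eta| <= D y.

Lemma osc_ge0 f D y : osc f D -> 0 <= D y.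
Proof. by move=> /(_ [ffun=> true] y true); apply: le_trans. Qed.

(** A duel overwrites both its endpoints, so it forgets a change at either of them; it commutes with
    a change anywhere else. *)
Lemma siteA_osc f D eta y b x : osc f D ->
  `|siteA f (upd eta y b) x - siteA f eta x| <=
  if (x == y) || (ordS x == y) then 0 else D y.
Proof.
move=> fD; rewrite /siteA !duelE.
have xS : ordS x != x by rewrite ordS_neq //; lia.
case: (eqVneq x y) => [<-|xy] /=.
  have c0 d := @updC _ eta x (ordS x) b d (ltac:(by rewrite eq_sym)).
  by rewrite !c0 !upd_upd subrr normr0.
case: (eqVneq (ordS x) y) => [<-|Sxy]; first by rewrite !upd_upd subrr normr0.
have c1 c : upd (upd (upd eta y b) (ordS x) (~~ c)) x c =
            upd (upd (upd eta (ordS x) (~~ c)) x c) y b.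
  by rewrite (@updC _ eta y (ordS x)) 1?eq_sym // (@updC _ _ y x) // eq_sym.
rewrite (c1 true) (c1 false).
have := fD (upd (upd eta (ordS x) (~~ true)) x true) y b.
by have := fD (upd (upd eta (ordS x) (~~ false)) x false) y b; rewrite !ler_norml; lra.
Qed.

Lemma scaled_avgB (F G : 'I_N -> R) :
  N%:R * `|N%:R^-1 * (\sum_x F x) - N%:R^-1 * (\sum_x G x)| <= \sum_x `|F x - G x|.
Proof.
rewrite -{1}(ger0_norm (ltW Ngt0)) -normrM mulrBr !mulVKf ?gt_eqF ?Ngt0 //.
by rewrite -sumrB ler_norm_sum.
Qed.

(** Two of the [N] edges contain [y], those drawn at [y] and at [ord_pred y], whence the factor
    [N - 2]. *)
Lemma opA_osc f D eta y b : osc f D ->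
  N%:R * `|opA f (upd eta y b) - opA f eta| <= (N%:R - 2) * D y.
Proof.
move=> fD; rewrite (le_trans (scaled_avgB _ _)) //.
rewrite (le_trans (ler_sum _ (fun x _ => siteA_osc eta y b x fD))) //.
have Sy : ord_pred y != y by rewrite ord_pred_neq //; lia.
under eq_bigr => x _.
  have -> : (if (x == y) || (ordS x == y) then 0 else D y) =
     D y - (if x == y then D y else 0) - (if x == ord_pred y then D y else 0).
    rewrite -ordS_eq; case: (eqVneq x y) => [->|_]; last first.
      by case: eqP => _; rewrite /=; ring.
    by rewrite ordS_eq eq_sym (negbTE Sy) /=; ring.
  over.
rewrite !sumrB -!big_mkcond /= !big_pred1_eq sumr_const card_ord -mulr_natl.
by rewrite le_eqVlt; apply/orP; left; apply/eqP; ring.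
Qed.

Hypothesis p01 : forall m : nat, (m < 4)%N -> 0 <= p`_m <= 1.

Lemma nbr_code_lt4 eta x : (nbr_code eta x < 4)%N.
Proof. by rewrite /nbr_code; case: (eta _); case: (eta _). Qed.

Lemma p_code01 eta x : 0 <= p`_(nbr_code eta x) <= 1.
Proof. by apply: p01; apply: nbr_code_lt4. Qed.

Lemma siteB_le f c eta x : (forall zeta, `|f zeta| <= c) -> `|siteB p f eta x| <= c.
Proof.
move=> fc; rewrite /siteB; have := fc (upd eta x true).
by have := fc (upd eta x false); have := p_code01 eta x; rewrite !ler_norml; nra.
Qed.

Lemma opB_le f c eta : (forall zeta, `|f zeta| <= c) -> `|opB p f eta| <= c.
Proof. by move=> fc; apply: avg_le => x; apply: siteB_le. Qed.

Variables (a c : R).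
Hypotheses (a01 : `|p`_0 - p`_1| <= a) (a23 : `|p`_2 - p`_3| <= a).
Hypotheses (c02 : `|p`_0 - p`_2| <= c) (c13 : `|p`_1 - p`_3| <= c).

Lemma a_ge0 : 0 <= a. Proof. exact: le_trans a01. Qed.

Lemma c_ge0 : 0 <= c. Proof. exact: le_trans c02. Qed.

(** Player [ordS y] sees [y] on its left, where a flip moves the code by 2 (bound [c]); player
    [ord_pred y] sees it on its right, where the code moves by 1 (bound [a]). *)
Lemma p_code_upd eta y b x :
  `|p`_(nbr_code (upd eta y b) x) - p`_(nbr_code eta x)| <=
  (if x == ordS y then c else 0) + (if x == ord_pred y then a else 0).
Proof.
have [a0 c0] := (a_ge0, c_ge0).
rewrite -ord_pred_eq -ordS_eq /nbr_code !ffunE.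
have := ord_pred_neqS x N2.
case: (eqVneq (ord_pred x) y) => [->|_]; case: (eqVneq (ordS x) y) => [->|_] //=.
- move=> _; rewrite addr0; case: b; case: (eta y); case: (eta (ordS x));
  first [by rewrite subrr normr0 | assumption | by rewrite distrC; assumption].
- move=> _; rewrite add0r; case: b; case: (eta y); case: (eta (ord_pred x));
  first [by rewrite subrr normr0 | assumption | by rewrite distrC; assumption].
- by rewrite subrr normr0 addr0.
Qed.

(** If [x = y] the change is overwritten, and the code of [x] ignores its own status. Otherwise the
    change at [y] persists and may also alter the win probability of [x]. *)
Lemma siteB_osc f D eta y b x : osc f D ->
  `|siteB p f (upd eta y b) x - siteB p f eta x| <=
  (if x == y then 0 else D y)
  + ((if x == ordS y then c else 0) + (if x == ord_pred y then a else 0)) * D x.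
Proof.
move=> fD; have := p_code_upd eta y b x; set k := (X in _ <= X) => kP.
have := p_code01 (upd eta y b) x; have := p_code01 eta x; move: kP.
rewrite /siteB; set q' := p`_ _; set q := p`_ _ => kP q01 q'01.
have k0 : 0 <= k by apply: le_trans kP.
have Dx := osc_ge0 x fD.
case: (eqVneq x y) => [xy|xy].
  have -> : q' = q.
    by rewrite /q' /q /nbr_code -xy !upd_neq ?ordS_neq ?ord_pred_neq // ltnW.
  by subst y; rewrite !upd_upd subrr normr0 add0r mulr_ge0.
have yx : y != x by rewrite eq_sym.
rewrite !(@updC _ _ y x _ _ yx).
have h1 := fD (upd eta x true) y b; have h2 := fD (upd eta x false) y b.
have := fD (upd eta x false) x true; rewrite upd_upd => h3.
set F1' := f (upd (upd eta x true) y b) in h1 *.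
set F0' := f (upd (upd eta x false) y b) in h2 *.
set F1 := f (upd eta x true) in h1 h3 *; set F0 := f (upd eta x false) in h2 h3 *.
(* Coupling decomposition: an average of oscillations at [y], plus the change of win probability
   times an oscillation at [x]. *)
have -> : q' * F1' + (1 - q') * F0' - (q * F1 + (1 - q) * F0) =
  (q' * (F1' - F1) + (1 - q') * (F0' - F0)) + (q' - q) * (F1 - F0) by ring.
rewrite (le_trans (ler_normD _ _)) // lerD //.
  by move: h1 h2; rewrite !ler_norml; nra.
by rewrite normrM ler_pM.
Qed.

Lemma opB_osc f D eta y b : osc f D ->
  N%:R * `|opB p f (upd eta y b) - opB p f eta| <=
  (N%:R - 1) * D y + c * D (ordS y) + a * D (ord_pred y).
Proof.
move=> fD; rewrite (le_trans (scaled_avgB _ _)) //.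
rewrite (le_trans (ler_sum _ (fun x _ => siteB_osc eta y b x fD))) //.
rewrite big_split /= -addrA lerD //.
  rewrite (bigD1 y) //= eqxx add0r (eq_bigr (fun=> D y)) => [|x /negbTE -> //].
  by rewrite sumr_const cardC1 card_ord -[D y *+ _]mulr_natl -subn1 natrB //; lia.
under eq_bigr do rewrite mulrDl.
rewrite big_split /= lerD //.
  rewrite (bigD1 (ordS y)) //= eqxx big1 ?addr0 // => x /negbTE ->.
  by rewrite mul0r.
rewrite (bigD1 (ord_pred y)) //= eqxx big1 ?addr0 // => x /negbTE ->.
by rewrite mul0r.
Qed.

End Contraction.

(** Telescoping, by resetting the sites of [s] one at a time. *)
Lemma osc_sum (R : realType) (N : nat) (f : state N -> R) (D : 'I_N -> R)
    (s : seq 'I_N) (eta zeta : state N) :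
  osc f D -> (forall z, z \notin s -> eta z = zeta z) ->
  `|f zeta - f eta| <= \sum_(y <- s) D y.
Proof.
move=> fD; elim: s eta => [|y s IHs] eta agree.
  have -> : eta = zeta by apply/ffunP => z; apply: agree.
  by rewrite subrr normr0 big_nil.
rewrite big_cons (le_trans (ler_distD (f (upd eta y (zeta y))) _ _)) //.
rewrite addrC lerD //; apply: IHs => z zs; rewrite ffunE.
by case: eqVneq => [->//|zy]; apply: agree; rewrite inE negb_or zy.
Qed.

(** * The mixture of the two games *)

Section Mixture.
Variables (R : realType) (N : nat) (p : 4.-tuple R) (gamma : R).
Hypothesis N2 : (2 < N)%N.
Implicit Types (f g : state N -> R) (eta zeta : state N) (x y : 'I_N).

Definition opC f eta : R := gamma * opA f eta + (1 - gamma) * opB p f eta.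

Definition PC : 'M[R]_#|state N| := gamma *: PA' R N + (1 - gamma) *: PB N p.

Lemma PC_fcol f : PC *m fcol f = fcol (opC f).
Proof.
rewrite mulmxDl -!scalemxAl PA_fcol // PB_fcol.
by apply/colP => i; rewrite !mxE.
Qed.

Lemma opA_cst (k : R) eta : opA (fun=> k) eta = k.
Proof.
rewrite /opA /siteA sumr_const card_ord -[X in _ * X]mulr_natl mulKf; first by field.
by rewrite pnatr_eq0; lia.
Qed.

Lemma opB_cst (k : R) eta : opB p (fun=> k) eta = k.
Proof.
rewrite /opB /siteB; under eq_bigr do rewrite -mulrDl addrC subrK mul1r.
by rewrite sumr_const card_ord -[X in _ * X]mulr_natl mulKf // pnatr_eq0; lia.
Qed.

Lemma opC_cst (k : R) eta : opC (fun=> k) eta = k.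
Proof. by rewrite /opC opA_cst opB_cst; ring. Qed.

Hypothesis p01 : forall m : nat, (m < 4)%N -> 0 <= p`_m <= 1.
Hypothesis g01 : 0 <= gamma <= 1.
Variables (a c : R).
Hypotheses (a01 : `|p`_0 - p`_1| <= a) (a23 : `|p`_2 - p`_3| <= a).
Hypotheses (c02 : `|p`_0 - p`_2| <= c) (c13 : `|p`_1 - p`_3| <= c).

(** The killing rate [1 + gamma] is [2 gamma + (1 - gamma)]: rate 2 from game A' and rate 1 from
    game B. *)
Lemma opC_osc f D eta y b : osc f D ->
  N%:R * `|opC f (upd eta y b) - opC f eta| <=
  (N%:R - (1 + gamma)) * D y + (1 - gamma) * (c * D (ordS y) + a * D (ord_pred y)).
Proof.
move=> fD; have := opA_osc N2 eta y b fD.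
have := opB_osc N2 p01 a01 a23 c02 c13 eta y b fD.
set B := opB _ _ _ - _; set A := opA _ _ - _ => hB hA.
have -> : opC f (upd eta y b) - opC f eta = gamma * A + (1 - gamma) * B.
  by rewrite /opC /A /B; ring.
have [g0' g1] := andP g01; have g0 : 0 <= 1 - gamma by lra.
have nAB : N%:R * `|gamma * A + (1 - gamma) * B| <=
    gamma * (N%:R * `|A|) + (1 - gamma) * (N%:R * `|B|).
  rewrite !(mulrCA _ N%:R) -mulrDr ler_wpM2l //.
  rewrite (le_trans (ler_normD _ _)) // !normrM (ger0_norm g0) ger0_norm //.
apply: (le_trans nAB); have := ler_wpM2l g0' hA; have := ler_wpM2l g0 hB; lra.
Qed.

End Mixture.

(** * Observables as column vectors, and the distance to the centre *)

Lemma fcol_inj (R : realType) (N : nat) (f g : state N -> R) : fcol f = fcol g -> f =1 g.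
Proof.
move=> /colP fg eta; have := fg (enum_rank eta).
by rewrite !mxE enum_rankK.
Qed.

Lemma fcol_surj (R : realType) (N : nat) (v : 'cV[R]_#|state N|) : {f | v = fcol f}.
Proof.
exists (fun eta => v (enum_rank eta) ord0).
by apply/colP => i; rewrite mxE enum_valK.
Qed.

Lemma inj_unitmx (F : fieldType) (n : nat) (A : 'M[F]_n) :
  (forall v : 'cV_n, A *m v = 0 -> v = 0) -> A \in unitmx.
Proof.
move=> Ainj; rewrite -unitmx_tr -row_free_unit -kermx_eq0.
apply/eqP/row_matrixP => i; rewrite row0; apply: trmx_inj; rewrite trmx0.
apply: Ainj; apply: trmx_inj.
by rewrite trmx_mul trmxK -row_mul mulmx_ker row0 trmx0.
Qed.

(** One of the two truncated differences vanishes, so this is the distance from [y] to [K], which on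
    this circle is also the cyclic one. *)
Definition cdist (K : nat) (y : 'I_K.*2.+1) : nat := ((y - K) + (K - y))%N.

(** The edge closing the circle joins two sites at distance [K], so it does not break the Lipschitz
    property. *)
Lemma cdist_ordS (K : nat) (y : 'I_K.*2.+1) :
  (cdist (ordS y) <= (cdist y).+1)%N /\ (cdist y <= (cdist (ordS y)).+1)%N.
Proof.
have := ltn_ord y; rewrite leq_eqVlt eqSS /cdist val_ordS => /orP[/eqP ->|yK].
  by rewrite modnn; lia.
by rewrite modn_small //; lia.
Qed.

Lemma cdist_ends (K : nat) :
  cdist (ord0 : 'I_K.*2.+1) = K /\ cdist (ord_max : 'I_K.*2.+1) = K.
Proof. by rewrite /cdist /=; lia. Qed.

(** * The Poisson equation *)

Section Poisson.
Variables (R : realType) (K : nat) (p : 4.-tuple R) (gamma : R).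
Hypothesis K0 : (0 < K)%N.
Hypothesis p01 : forall m : nat, (m < 4)%N -> 0 <= p`_m <= 1.
Hypothesis g01 : 0 <= gamma <= 1.
Variables (a c rho kappa : R).
Hypotheses (a01 : `|p`_0 - p`_1| <= a) (a23 : `|p`_2 - p`_3| <= a).
Hypotheses (c02 : `|p`_0 - p`_2| <= c) (c13 : `|p`_1 - p`_3| <= c).
Hypotheses (rho0 : 0 < rho) (rho1 : rho < 1) (kappa0 : 0 < kappa).
Hypothesis kappaE : kappa = 1 + gamma - (1 - gamma) * (a + c) / rho.

Notation M := K.*2.+1.
Implicit Types (f g e : state M -> R) (eta zeta : state M) (x y : 'I_M).

Let decay y : R := rho ^+ cdist y.

Lemma decay_gt0 y : 0 < decay y.
Proof. exact: exprn_gt0. Qed.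

Lemma decay_step (m n : nat) : (m <= n.+1)%N -> rho * rho ^+ n <= rho ^+ m.
Proof.
by move=> mn; rewrite -exprS ler_wiXn2l // ltW.
Qed.

(* Maximum principle for the oscillation of [f] weighted by [rho ^- cdist]. *)
Lemma poisson_osc f e (k E : R) :
  (forall eta, M%:R * (f eta - opC p gamma f eta) = e eta - k) ->
  osc e (fun y => E * decay y) -> osc f (fun y => E / kappa * decay y).
Proof.
move=> fe eE.
(* The largest weighted oscillation [W] is attained, there being finitely many triples; the profile
   [W * decay] is then sharp at the maximizer. *)
pose F (t : state M * 'I_M * bool) : R :=
  `|f (upd t.1.1 t.1.2 t.2) - f t.1.1| / decay t.1.2.
have [t _ tmax] := @arg_maxP _ R _ ([ffun=> true], ord0, true) xpredT F isT.
have {}tmax u : F u <= F t by apply: tmax.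
have [W WE] : exists W, W = F t by exists (F t).
rewrite -WE in tmax.
have fW : osc f (fun y => W * decay y).
  by move=> eta y b; rewrite -ler_pdivrMr ?decay_gt0 //; apply: (tmax (eta, y, b)).
suff W_le : W <= E / kappa.
  by move=> eta y b; rewrite (le_trans (fW _ _ _)) // ler_wpM2r // ltW ?decay_gt0.
case: t WE => [[eta y] b]; rewrite /F /= => WE.
have M2 : (2 < M)%N by rewrite ltnS -[2%N]/(1.*2)%N leq_double.
have := opC_osc M2 p01 g01 a01 a23 c02 c13 eta y b fW.
have := eE eta y b; set e' := _ - e _; set C' := opC _ _ _ _ - _ => he hC.
have W0 : 0 <= W by rewrite WE divr_ge0 // ltW ?decay_gt0.
have hW : W * decay y = `|f (upd eta y b) - f eta|.
  by rewrite WE divfK // gt_eqF ?decay_gt0.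
(* Difference of the Poisson equation at two configurations; the constant [k] cancels. *)
have eM : M%:R * (f (upd eta y b) - f eta) = M%:R * C' + e'.
  have := fe (upd eta y b); have := fe eta; rewrite /C' /e' !mulrBr; lra.
have : M%:R * (W * decay y) <= M%:R * `|C'| + `|e'|.
  have -> : M%:R * (W * decay y) = `|M%:R * (f (upd eta y b) - f eta)|.
    by rewrite hW normrM ger0_norm.
  by rewrite eM (le_trans (ler_normD _ _)) // normrM ger0_norm.
have [_ dS] := cdist_ordS y; have [dP _] := cdist_ordS (ord_pred y).
rewrite ord_predK in dP.
have := decay_step dS; have := decay_step dP.
rewrite -/(decay y) -/(decay (ordS y)) -/(decay (ord_pred y)) => hP hS hM.
have [g0 g1] := andP g01.
have cS : c * (W * decay (ordS y)) * rho <= c * W * decay y.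
  by rewrite -!mulrA ler_wpM2l ?(c_ge0 c02) // ler_wpM2l // mulrC.
have aP : a * (W * decay (ord_pred y)) * rho <= a * W * decay y.
  by rewrite -!mulrA ler_wpM2l ?(a_ge0 a01) // ler_wpM2l // mulrC.
rewrite ler_pdivlMr // -(ler_pM2r (decay_gt0 y)) -(ler_pM2r rho0).
have -> : W * kappa * decay y * rho =
    ((1 + gamma) * rho - (1 - gamma) * (a + c)) * (W * decay y).
  by rewrite kappaE; field; rewrite gt_eqF.
(* The terms of order [M] cancel, leaving the killing at [y] against the influx from its neighbours
   and the source. Multiplying by [rho] then compares the neighbouring weights with [decay y]. *)
have key : (1 + gamma) * (W * decay y) <= (1 - gamma) *
    (c * (W * decay (ordS y)) + a * (W * decay (ord_pred y))) + E * decay y by lra.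
have := ler_wpM2r (ltW rho0) key.
have g1' : 0 <= 1 - gamma by lra.
have := ler_wpM2l g1' (lerD cS aP); lra.
Qed.

(* The rank-one perturbation [f eta0] of [I - P] makes it injective, and its
   value is the additive constant of the Poisson equation. *)
Lemma poisson_solvable g : exists f k,
  forall eta, M%:R * (f eta - opC p gamma f eta) = g eta - k.
Proof.
have M2 : (2 < M)%N by rewrite ltnS -[2%N]/(1.*2)%N leq_double.
have M0 : M%:R != 0 :> R by rewrite pnatr_eq0.
pose eta0 : state M := [ffun=> true].
pose T : 'M[R]_#|state M| :=
  1%:M - PC M p gamma + \matrix_(i, j) (j == enum_rank eta0)%:R.
have T_fcol f : T *m fcol f = fcol (fun eta => f eta - opC p gamma f eta + f eta0).
  rewrite mulmxDl mulmxBl mul1mx PC_fcol //; apply/colP => i; rewrite !mxE.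
  congr (_ + _); rewrite (bigD1 (enum_rank eta0)) //= big1 => [|j /negbTE jn].
    by rewrite !mxE eqxx mul1r addr0 enum_rankK.
  by rewrite !mxE jn mul0r.
have T_unit : T \in unitmx.
  apply: inj_unitmx => v; have [f ->] := fcol_surj v; rewrite T_fcol => Tf0.
  have f0 eta : f eta - opC p gamma f eta + f eta0 = 0.
    by move: eta; apply: fcol_inj; rewrite Tf0; apply/colP => i; rewrite !mxE.
  have fosc : osc f (fun y => 0 / kappa * decay y).
    (* A kernel vector of [T] solves a Poisson equation with zero source, so it has no oscillation
       and is constant; evaluating at [eta0] shows that the constant is 0. *)
    apply: (@poisson_osc f (fun=> 0) (M%:R * f eta0) 0) => [zeta|zeta z b'].
      by rewrite (_ : f zeta - _ = - f eta0); [ring | have := f0 zeta; lra].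
    by rewrite subrr normr0 mul0r.
  have fc eta : f eta = f eta0.
    apply/eqP; rewrite -subr_eq0 -normr_le0.
    apply: (le_trans (@osc_sum _ _ _ _ (enum 'I_M) eta0 eta fosc _)) => [z|].
      by rewrite mem_enum.
    by rewrite big1 // => z _; rewrite !mul0r.
  have fE : f = fun=> f eta0 by apply: funext => eta; apply: fc.
  have := f0 eta0; rewrite [in opC _ _ _ _]fE opC_cst // subrr add0r => fz.
  by rewrite fE fz; apply/colP => i; rewrite !mxE.
have [f fP] := fcol_surj (invmx T *m fcol (fun eta => g eta / M%:R)).
exists f, (M%:R * f eta0) => eta.
have : T *m fcol f = fcol (fun eta => g eta / M%:R) by rewrite -fP mulKVmx.
rewrite T_fcol => /fcol_inj/(_ eta) h.
have -> : f eta - opC p gamma f eta = g eta / M%:R - f eta0 by rewrite -h; ring.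
by field.
Qed.

End Poisson.

(** * Windows in a longer circle *)

Lemma ordS_max (K : nat) : ordS (ord_max : 'I_K.*2.+1) = ord0.
Proof. by apply: val_inj; rewrite val_ordS /= modnn. Qed.

Definition wcenter (K : nat) : 'I_K.*2.+1 := @inord K.*2 K.

Lemma wcenterE (K : nat) : wcenter K = K :> nat.
Proof. by rewrite inordK //; lia. Qed.

Lemma duel_other (n : nat) (zeta : state n) (y y' z : 'I_n) (b : bool) :
  z != y -> z != y' -> duel zeta y y' b z = zeta z.
Proof. by move=> zy zy'; rewrite ffunE (negbTE zy) (negbTE zy'). Qed.

Lemma siteA_sub_le (R : realType) (n : nat) (h : state n -> R) (d : R)
    (zeta : state n) (y : 'I_n) :
  (forall b, `|h (duel zeta y (ordS y) b) - h zeta| <= d) ->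
  `|siteA h zeta y - h zeta| <= d.
Proof.
by move=> hd; have := hd true; have := hd false; rewrite /siteA !ler_norml; lra.
Qed.

Lemma siteB_sub_le (R : realType) (p : 4.-tuple R) (n : nat)
    (h : state n -> R) (d : R) (zeta : state n) (y : 'I_n) :
  (forall m : nat, (m < 4)%N -> 0 <= p`_m <= 1) ->
  (forall b, `|h (upd zeta y b) - h zeta| <= d) ->
  `|siteB p h zeta y - h zeta| <= d.
Proof.
move=> p01 hd; have := hd true; have := hd false; have := p_code01 p01 zeta y.
by rewrite /siteB !ler_norml; nra.
Qed.

Lemma avg_sub (R : realType) (n : nat) (s : 'I_n -> R) (k : R) : (0 < n)%N ->
  n%:R * (n%:R^-1 * \sum_y s y - k) = \sum_y (s y - k).
Proof.
move=> n0; rewrite sumrB sumr_const card_ord mulrBr mulVKf ?mulr_natl //.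
by rewrite pnatr_eq0 -lt0n.
Qed.

Section Window.
Variables (R : realType) (K N : nat).
Notation M := K.*2.+1.
Hypothesis K0 : (0 < K)%N.
Hypothesis MN : (M <= N)%N.
Variable x : 'I_N.
Implicit Types (eta : state N) (j : 'I_M) (z : 'I_N).

(** Starts [K] sites to the left of [x], so that the centre of the short circle falls on [x]. *)
Definition wpos j : 'I_N := iter j (@ordS N) (iter K (@ord_pred N) x).

Definition window eta : state M := [ffun j => eta (wpos j)].

Lemma wpos_inj : injective wpos.
Proof.
move=> i j /(congr1 val); rewrite /wpos !val_iter_ordS => /eqP.
rewrite eqn_modDl !modn_small => [/eqP/val_inj //||]; exact: leq_trans (ltn_ord _) MN.
Qed.

Lemma wposS j : j != ord_max -> wpos (ordS j) = ordS (wpos j).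
Proof.
move=> jm; rewrite {1}/wpos val_ordS modn_small // ltnS ltn_neqAle.
by rewrite -ltnS ltn_ord andbT.
Qed.

Lemma wpos_pred j : j != ord0 -> wpos (ord_pred j) = ord_pred (wpos j).
Proof.
move=> j0; rewrite -{2}(ord_predK j) wposS ?ordSK //.
by apply: contra j0; rewrite ord_pred_eq ordS_max.
Qed.

Lemma wpos_center : wpos (wcenter K) = x.
Proof.
rewrite /wpos wcenterE; elim: (K) => // k IHk.
by rewrite iterSr iterS ord_predK.
Qed.

Lemma nbr_code_window eta j : j != ord0 -> j != ord_max ->
  nbr_code (window eta) j = nbr_code eta (wpos j).
Proof. by move=> j0 jm; rewrite /nbr_code !ffunE wposS // wpos_pred. Qed.

Lemma window_upd eta j b : window (upd eta (wpos j) b) = upd (window eta) j b.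
Proof. by apply/ffunP => i; rewrite !ffunE (inj_eq wpos_inj). Qed.

Lemma window_upd_out eta z b : (forall j, z != wpos j) -> window (upd eta z b) = window eta.
Proof.
by move=> zj; apply/ffunP => i; rewrite !ffunE eq_sym (negbTE (zj i)).
Qed.

Variables (f : state M -> R) (D : 'I_M -> R).
Hypothesis fD : osc f D.

Let F eta : R := f (window eta).

Let delta : R := D ord0 + D ord_max.

Lemma delta_ge0 : 0 <= delta.
Proof. by rewrite addr_ge0 // (osc_ge0 _ fD). Qed.

Lemma osc_ends (zeta zeta' : state M) :
  (forall j, j != ord0 -> j != ord_max -> zeta j = zeta' j) ->
  `|f zeta' - f zeta| <= delta.
Proof.
move=> agree; have := @osc_sum _ _ f D [:: ord0; ord_max] zeta zeta' fD.
rewrite !big_cons big_nil addr0; apply => j.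
by rewrite !inE negb_or => /andP[]; apply: agree.
Qed.

(** [S] and [T] stand for the site contributions to the two generators. They agree inside the
    window; the two ends cost at most [2 * delta] each, and outside only the site just left of the
    window may contribute, at most [delta]. *)
Lemma window_sum (S : 'I_N -> R) (T : 'I_M -> R) :
  (forall j, S (wpos j) = T j \/
     [/\ (j == ord0) || (j == ord_max), `|S (wpos j)| <= delta & `|T j| <= delta]) ->
  (forall z, (forall j, z != wpos j) -> z != ord_pred (wpos ord0) -> S z = 0) ->
  ((forall j, ord_pred (wpos ord0) != wpos j) ->
     `|S (ord_pred (wpos ord0))| <= delta) ->
  `|\sum_z S z - \sum_j T j| <= 5 * delta.
Proof.
move=> inner outer out0; have d0 := delta_ge0.
rewrite (bigID (mem [set wpos j | j : 'I_M])) /= big_imset => [|i j _ _]; last exact: wpos_inj.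
rewrite addrAC (le_trans (ler_normD _ _)) //.
have -> : 5 * delta = 4 * delta + delta by ring.
apply: lerD.
  rewrite (eq_bigl xpredT) // -sumrB (le_trans (ler_norm_sum _ _ _)) //.
  apply: (@le_trans _ _ (\sum_(j : 'I_M) ((if j == ord0 then 2 * delta else 0) +
                                   (if j == ord_max then 2 * delta else 0)))).
    apply: ler_sum => j _; case: (inner j) => [->|[je Sj Tj]].
      by rewrite subrr normr0 addr_ge0 //; case: ifP => _; lra.
    rewrite (le_trans (ler_normB _ _)) //.
    by case/orP: je => ->; case: ifP => _; lra.
  rewrite big_split -!big_mkcond /= !big_pred1_eq; lra.
rewrite (le_trans (ler_norm_sum _ _ _)) //.
rewrite (big_mkcond (fun z => z \notin _)) /=.
apply: (@le_trans _ _ (\sum_(z : 'I_N) (if z == ord_pred (wpos ord0) then delta else 0))).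
  apply: ler_sum => z _; case: ifPn => [zn|_]; last by case: ifP.
  have zj j : z != wpos j by apply: contra zn => /eqP ->; apply: imset_f.
  case: eqVneq => [zE|zn0]; last by rewrite outer // normr0.
  by rewrite zE; apply: out0 => j; rewrite -zE.
by rewrite -big_mkcond big_pred1_eq.
Qed.

Lemma window_opA eta :
  `|N%:R * (opA F eta - F eta) - M%:R * (opA f (window eta) - f (window eta))| <=
  5 * delta.
Proof.
rewrite /opA !avg_sub //; last lia.
have inj := wpos_inj.
(* The site preceding the window can lie in it only as its last site, when the window fills the
   whole circle. *)
have pred_last j : wpos j = ord_pred (wpos ord0) -> j = ord_max.
  move=> jE; apply/eqP; apply/negPn/negP => jm.
  have : wpos (ordS j) = wpos ord0 by rewrite wposS // jE ord_predK.
  by move/inj/eqP; rewrite ordS_eq -ordS_max ordSK (negbTE jm).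
apply: window_sum.
- move=> j; case: (eqVneq j ord_max) => [->|jm]; last first.
    by left; rewrite /siteA /F -wposS // !duelE !window_upd.
  right; rewrite orbT; split=> //; apply: siteA_sub_le => b;
    apply: osc_ends => i i0 im; last by rewrite duel_other // ordS_max.
  rewrite !ffunE (inj_eq inj) (negbTE im); case: eqP => // /eqP.
  rewrite eq_sym ordS_eq -wpos_pred // => /eqP/inj/esym/eqP.
  by rewrite ord_pred_eq ordS_max (negbTE i0).
- move=> z zout z0; rewrite /siteA /F.
  have Sz j : ordS z != wpos j.
    have [->|j0] := eqVneq j ord0; first by rewrite ordS_eq.
    by rewrite ordS_eq -wpos_pred.
  by rewrite !duelE !window_upd_out //; field.
- move=> _; apply: siteA_sub_le => b; apply: osc_ends => i i0 im.
  rewrite ord_predK !ffunE (inj_eq inj) (negbTE i0).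
  by case: eqP => // /pred_last/eqP; rewrite (negbTE im).
Qed.

Variable p : 4.-tuple R.
Hypothesis p01 : forall m : nat, (m < 4)%N -> 0 <= p`_m <= 1.

(** Only the two end players have different neighbours in the two circles, and resetting an end
    costs at most [delta]; players outside the window do not touch it. *)
Lemma window_opB eta :
  `|N%:R * (opB p F eta - F eta) - M%:R * (opB p f (window eta) - f (window eta))| <=
  5 * delta.
Proof.
rewrite /opB !avg_sub //; last lia.
have fin (zeta : state M) j b : (j == ord0) || (j == ord_max) ->
    `|f (upd zeta j b) - f zeta| <= delta.
  move=> je; apply: osc_ends => i i0 im; rewrite upd_neq //.
  by case/orP: je => /eqP ->.
apply: window_sum.
- move=> j; case/boolP: ((j == ord0) || (j == ord_max)) => [je|]; last first.
    by rewrite negb_or => /andP[j0 jm]; left; rewrite /siteB /F !window_upd nbr_code_window.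
  right; split=> //; apply: (siteB_sub_le p01) => b; last exact: fin.
  by rewrite /F window_upd fin.
- by move=> z zout _; rewrite /siteB /F !window_upd_out //; ring.
- move=> zout; apply: (siteB_sub_le p01) => b.
  by rewrite /F window_upd_out // subrr normr0 delta_ge0.
Qed.

Variable gamma : R.
Hypothesis g01 : 0 <= gamma <= 1.

Lemma window_opC eta :
  `|N%:R * (opC p gamma F eta - F eta)
    - M%:R * (opC p gamma f (window eta) - f (window eta))| <= 5 * delta.
Proof.
have := window_opA eta; have := window_opB eta; have [g0 g1] := andP g01.
rewrite /opC; set OB := opB p F eta; set oB := opB p f _.
set OA := opA F eta; set oA := opA f _; set v := F eta; set w := f _.
set n := N%:R; set m := _%:R => hB hA.
have -> : n * (gamma * OA + (1 - gamma) * OB - v) - m * (gamma * oA + (1 - gamma) * oB - w)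
  = gamma * (n * (OA - v) - m * (oA - w)) + (1 - gamma) * (n * (OB - v) - m * (oB - w)).
  by ring.
have g1' : 0 <= 1 - gamma by lra.
rewrite (le_trans (ler_normD _ _)) // !normrM (ger0_norm g0) (ger0_norm g1').
have := ler_wpM2l g0 hA; have := ler_wpM2l g1' hB; lra.
Qed.

End Window.

(** * Local observables and words of rounds *)

(** Only the size of the support and the sup norm are recorded, so that estimates can be iterated
    without tracking positions. *)
Definition local (R : realType) (N k : nat) (c : R) (f : state N -> R) : Prop :=
  exists S : {set 'I_N}, [/\ (#|S| <= k)%N,
    forall eta zeta : state N, {in S, eta =1 zeta} -> f eta = f zeta &
    forall eta, `|f eta| <= c].

Section Local.
Variables (R : realType) (N : nat) (p : 4.-tuple R).
Hypothesis N2 : (2 < N)%N.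
Hypothesis p01 : forall m : nat, (m < 4)%N -> 0 <= p`_m <= 1.
Implicit Types (f g : state N -> R) (eta zeta : state N) (x y : 'I_N).

(** Contains every site whose round can alter an observable supported in [S], and every site read by
    game B in such a round. *)
Definition nbhd1 (S : {set 'I_N}) : {set 'I_N} :=
  S :|: ((@ordS N) @: S :|: (@ord_pred N) @: S).

Lemma card_nbhd1 S : (#|nbhd1 S| <= 3 * #|S|)%N.
Proof.
rewrite !mulSn mul0n addn0 /nbhd1 cardsU (leq_trans (leq_subr _ _)) // leq_add2l.
by rewrite cardsU (leq_trans (leq_subr _ _)) // leq_add // leq_imset_card.
Qed.

Lemma nbhd1P S x : x \notin nbhd1 S -> x \notin S /\ ordS x \notin S.
Proof.
rewrite !inE !negb_or => /and3P[xS _ xP]; split=> //.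
by apply: contra xP => Sx; apply/imsetP; exists (ordS x); rewrite ?ordSK.
Qed.

(** After subtracting [f], at most [3 k] sites contribute, each at most [2 c]; the average divides
    by [N]. *)
Lemma avg_local (site : state N -> 'I_N -> R) f (S : {set 'I_N}) k (c : R) :
  (#|S| <= k)%N -> 0 <= c -> (forall eta, `|f eta| <= c) ->
  (forall eta x, `|site eta x| <= c) ->
  (forall eta zeta, {in S, eta =1 zeta} -> f eta = f zeta) ->
  (forall eta x, x \notin nbhd1 S -> site eta x = f eta) ->
  (forall eta zeta x, x \in nbhd1 S -> {in nbhd1 S, eta =1 zeta} ->
      site eta x = site zeta x) ->
  local (3 * k) (6 * k%:R * c / N%:R) (fun eta => N%:R^-1 * (\sum_x site eta x) - f eta).
Proof.
move=> Sk c0 fc sc fS out dep; exists (nbhd1 S).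
have N0 : N%:R != 0 :> R by rewrite pnatr_eq0; lia.
have E eta : N%:R^-1 * (\sum_x site eta x) - f eta =
    N%:R^-1 * \sum_(x in nbhd1 S) (site eta x - f eta).
  rewrite -[f eta in LHS](mulKf N0) -mulrBr; congr (_ * _).
  rewrite mulr_natl -[in f eta *+ _](card_ord N) -sumr_const -sumrB.
  rewrite (bigID (mem (nbhd1 S))) /= [X in _ + X]big1 ?addr0 // => x xS.
  by rewrite out // subrr.
have S3 : (#|nbhd1 S| <= 3 * k)%N.
  by rewrite (leq_trans (card_nbhd1 S)) // leq_mul2l.
split=> // [eta zeta ez|eta].
  have fez : f eta = f zeta.
    by apply: fS => x xS; apply: ez; rewrite inE xS.
  by rewrite !E fez; congr (_ * _); apply: eq_bigr => x xS; rewrite (dep _ _ _ xS ez).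
rewrite E normrM ger0_norm ?invr_ge0 // mulrC ler_pM2r ?invr_gt0 ?ltr0n //; last lia.
rewrite (le_trans (ler_norm_sum _ _ _)) //.
apply: (@le_trans _ _ (\sum_(x in nbhd1 S) (2 * c))).
  apply: ler_sum => x _; rewrite (le_trans (ler_normB _ _)) //.
  have := sc eta x; have := fc eta; lra.
rewrite sumr_const -[X in X <= _]mulr_natl.
have -> : 6 * k%:R * c = (3 * k)%:R * (2 * c) by rewrite natrM; ring.
by rewrite ler_wpM2r ?mulr_ge0 // ler_nat.
Qed.

Lemma upd_agree (S : {set 'I_N}) eta zeta x b :
  {in S, eta =1 zeta} -> {in S, upd eta x b =1 upd zeta x b}.
Proof. by move=> ez z zS; rewrite !ffunE; case: eqP => // _; apply: ez. Qed.

Lemma local_ge0 k (c : R) f : local k c f -> 0 <= c.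
Proof. by case=> S [_ _ /(_ [ffun=> true])]; apply: le_trans. Qed.

Lemma opA_local k (c : R) f : local k c f ->
  local (3 * k) (6 * k%:R * c / N%:R) (fun eta => opA f eta - f eta).
Proof.
move=> fl; have c0 := local_ge0 fl; have [S [Sk fS fc]] := fl.
apply: (avg_local Sk c0 fc) => // [eta x|eta x /nbhd1P[xS SxS]|eta zeta x _ ez].
- exact: siteA_le.
- have E b : f (duel eta x (ordS x) b) = f eta.
    apply: fS => z zS; rewrite duel_other //; first by apply: contraNneq xS => <-.
    by apply: contraNneq SxS => <-.
  by rewrite /siteA !E; field.
- have {}ez : {in S, eta =1 zeta} by move=> z zS; apply: ez; rewrite inE zS.
  by rewrite /siteA !duelE; do 2 (congr (_ * _) || congr (_ + _)); apply: fS;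
    do 2 apply: upd_agree.
Qed.

Lemma opB_local k (c : R) f : local k c f ->
  local (3 * k) (6 * k%:R * c / N%:R) (fun eta => opB p f eta - f eta).
Proof.
move=> fl; have c0 := local_ge0 fl; have [S [Sk fS fc]] := fl.
have out eta x : x \notin S -> siteB p f eta x = f eta.
  move=> xS; have E b : f (upd eta x b) = f eta.
    by apply: fS => z zS; rewrite upd_neq //; apply: contraNneq xS => <-.
  by rewrite /siteB !E; ring.
apply: (avg_local Sk c0 fc) => // [eta x|eta x /nbhd1P[xS _]|eta zeta x _ ez].
- exact: siteB_le.
- exact: out.
- have ezS : {in S, eta =1 zeta} by move=> z zS; apply: ez; rewrite inE zS.
  have [xS|xS] := boolP (x \in S); last by rewrite !out // (fS _ _ ezS).
  have e b : f (upd eta x b) = f (upd zeta x b) by apply: fS; apply: upd_agree.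
  by rewrite /siteB /nbr_code !e !ez ?inE ?imset_f ?orbT.
Qed.

(* A word in [{true, false}] lists rounds in the order in which they are
   played, [true] for game A' and [false] for game B. *)
Definition op (b : bool) : (state N -> R) -> state N -> R :=
  if b then @opA R N else opB p.

Lemma op_local b k (c : R) f : local k c f ->
  local (3 * k) (6 * k%:R * c / N%:R) (fun eta => op b f eta - f eta).
Proof. by case: b; [apply: opA_local | apply: opB_local]. Qed.

Lemma op_le b f (c : R) eta : (forall zeta, `|f zeta| <= c) -> `|op b f eta| <= c.
Proof. by case: b => fc; [apply: opA_le | apply: opB_le]. Qed.

Lemma opD b f g eta : op b (fun zeta => f zeta + g zeta) eta = op b f eta + op b g eta.
Proof.
case: b; rewrite /op /opA /opB -[in RHS]mulrDr -[in RHS]big_split /=; congr (_ * _);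
  by apply: eq_bigr => x _; rewrite /siteA /siteB; ring.
Qed.

Lemma opZ b (k : R) f eta : op b (fun zeta => k * f zeta) eta = k * op b f eta.
Proof.
case: b; rewrite /op /opA /opB [in RHS]mulrCA [in RHS]mulr_sumr; congr (_ * _);
  by apply: eq_bigr => x _; rewrite /siteA /siteB; ring.
Qed.

Lemma op_sub b f g eta :
  op b (fun zeta => f zeta - g zeta) eta = op b f eta - op b g eta.
Proof.
have -> : (fun zeta => f zeta - g zeta) = (fun zeta => f zeta + -1 * g zeta).
  by apply: funext => zeta; rewrite mulN1r.
by rewrite opD opZ mulN1r.
Qed.

Lemma op_sum b (I : Type) (w : seq I) (F : I -> state N -> R) eta :
  op b (fun zeta => \sum_(d <- w) F d zeta) eta = \sum_(d <- w) op b (F d) eta.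
Proof.
elim: w => [|d w IHw].
  have -> : (fun zeta => \sum_(d <- [::]) F d zeta) = (fun zeta => 0 * (0 : R)).
    by apply: funext => zeta; rewrite big_nil mul0r.
  by rewrite opZ mul0r big_nil.
rewrite big_cons -IHw -opD; congr (op _ _ _).
by apply: funext => zeta; rewrite big_cons.
Qed.

Definition opw (w : seq bool) f : state N -> R := foldr op f w.

(** Telescoping over the rounds, as each operator is a contraction for the sup norm. *)
Lemma opw_sub_le w k (c : R) f eta : local k c f ->
  `|opw w f eta - f eta| <= (size w)%:R * (6 * k%:R * c / N%:R).
Proof.
move=> fl; elim: w eta => [|b w IHw] eta /=; first by rewrite subrr normr0 mul0r.
have -> : op b (opw w f) eta - f eta =
    op b (fun zeta => opw w f zeta - f zeta) eta + (op b f eta - f eta).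
  by rewrite op_sub; ring.
rewrite (le_trans (ler_normD _ _)) // -natr1 mulrDl mul1r lerD //.
  exact: op_le.
by have [S [_ _]] := op_local b fl; apply.
Qed.

(** Moving one increment through a further round is a double difference, and [op_local] applied
    twice bounds it with [6 * 3 * 6 = 108]. Prepending a round to a word of length [n] adds [n] such
    terms, and [n ^ 2 + n <= (n + 1) ^ 2]. *)
Lemma opw_second_order w k (c : R) f eta : local k c f ->
  `|opw w f eta - f eta - \sum_(b <- w) (op b f eta - f eta)| <=
  (size w)%:R ^+ 2 * (108 * k%:R ^+ 2 * c / N%:R ^+ 2).
Proof.
move=> fl; set B := 108 * _ * _ / _.
have B0 : 0 <= B.
  by rewrite divr_ge0 ?exprn_ge0 // mulr_ge0 ?(local_ge0 fl) // mulr_ge0 ?exprn_ge0.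
have second b d zeta : `|op b (fun t => op d f t - f t) zeta - (op d f zeta - f zeta)| <= B.
  have [S [_ _ /(_ zeta)]] := op_local b (op_local d fl).
  move/le_trans; apply; rewrite /B natrM le_eqVlt; apply/orP; left; apply/eqP.
  by field; rewrite pnatr_eq0; lia.
elim: w eta => [|b w IHw] eta /=.
  by rewrite big_nil subrr subr0 normr0 expr2 !mul0r.
pose rest zeta := opw w f zeta - f zeta - \sum_(d <- w) (op d f zeta - f zeta).
have -> : op b (opw w f) eta - f eta - \sum_(d <- b :: w) (op d f eta - f eta) =
   op b rest eta + \sum_(d <- w) (op b (fun t => op d f t - f t) eta - (op d f eta - f eta)).
  rewrite /rest !op_sub op_sum big_cons [in RHS]sumrB; ring.
rewrite (le_trans (ler_normD _ _)) //.
apply: (@le_trans _ _ ((size w)%:R ^+ 2 * B + (size w)%:R * B)).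
  apply: lerD; first exact: op_le.
  rewrite (le_trans (ler_norm_sum _ _ _)) // (le_trans (ler_sum _ (fun d _ => second b d eta))) //.
  by rewrite big_const_seq count_predT iter_addr_0 mulr_natl.
rewrite -mulrDl ler_wpM2r // -natr1; have := ler0n R (size w); nra.
Qed.

End Local.

(** * Expectations under stationary laws of the two chains *)

Section Expectation.
Variables (R : realType) (N : nat) (p : 4.-tuple R).
Hypothesis N2 : (2 < N)%N.
Hypothesis p01 : forall m : nat, (m < 4)%N -> 0 <= p`_m <= 1.
Implicit Types (f g : state N -> R) (eta zeta : state N) (x y : 'I_N).
Variable nu : 'rV[R]_#|state N|.
Hypotheses (nu0 : forall j, 0 <= nu ord0 j) (nu1 : \sum_j nu ord0 j = 1).

Lemma expect_le f (c : R) : (forall eta, `|f eta| <= c) -> `|expect nu f| <= c.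
Proof.
move=> fc; rewrite (le_trans (ler_norm_sum _ _ _)) // -[c]mul1r -nu1 mulr_suml.
by apply: ler_sum => i _; rewrite normrM ger0_norm // ler_wpM2l.
Qed.

Lemma expectB f g : expect nu (fun eta => f eta - g eta) = expect nu f - expect nu g.
Proof. by rewrite /expect -sumrB; apply: eq_bigr => i _; rewrite mulrBr. Qed.

Lemma expectZ (k : R) f : expect nu (fun eta => k * f eta) = k * expect nu f.
Proof. by rewrite /expect mulr_sumr; apply: eq_bigr => i _; rewrite mulrCA. Qed.

Lemma expect_cst (k : R) : expect nu (fun=> k) = k.
Proof. by rewrite /expect -mulr_suml nu1 mul1r. Qed.

Lemma PA_iter_fcol n f : PA' R N ^+ n *m fcol f = fcol (iter n (@opA R N) f).
Proof.
elim: n => [|n IHn]; first by rewrite expr0 mul1mx.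
by rewrite exprS -mulmxA IHn PA_fcol.
Qed.

Lemma PB_iter_fcol n f : PB N p ^+ n *m fcol f = fcol (iter n (opB p) f).
Proof.
elim: n => [|n IHn]; first by rewrite expr0 mul1mx.
by rewrite exprS -mulmxA IHn PB_fcol.
Qed.

(** [foldr] applies the last round first, as does a matrix product acting on a column. *)
Lemma pattern_fcol r s f :
  PA' R N ^+ r *m PB N p ^+ s *m fcol f = fcol (opw p (nseq r true ++ nseq s false) f).
Proof.
rewrite -mulmxA PB_iter_fcol PA_iter_fcol /opw foldr_cat; congr fcol.
have -> : foldr (op p) f (nseq s false) = iter s (opB p) f.
  by elim: s => //= s ->.
by elim: r => //= r ->.
Qed.

Lemma PA_ge0 i j : 0 <= PA' R N i j.
Proof. by rewrite mxE mulr_ge0 // invr_ge0. Qed.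

Lemma PB_ge0 i j : 0 <= PB N p i j.
Proof.
have pq eta x : 0 <= p`_(nbr_code eta x) /\ 0 <= 1 - p`_(nbr_code eta x).
  by have := p_code01 p01 eta x; split; lra.
rewrite mxE /kernelB; case: ifP => _.
  rewrite mulr_ge0 ?invr_ge0 // addr_ge0 // sumr_ge0 // => x _; by case: (pq (enum_val i) x).
apply: sumr_ge0 => x _; rewrite mulr_ge0 ?invr_ge0 //.
by case: (pq (enum_val i) x) => ? ?; case: ifP.
Qed.

Lemma fcol1 : fcol (fun=> 1) = const_mx 1 :> 'cV[R]_#|state N|.
Proof. by apply/colP => i; rewrite !mxE. Qed.

Lemma card_state_gt0 : (0 < #|state N|)%N.
Proof. by apply/card_gt0P; exists [ffun=> true]. Qed.

Variable gamma : R.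
Hypothesis g01 : 0 <= gamma <= 1.

Lemma mix_stationary : is_stationary (PC N p gamma) (stationary (PC N p gamma)).
Proof.
apply: stationaryP; first exact: card_state_gt0.
  move=> i j; rewrite !mxE -[X in _ * X + _]/(kernelA' _ _ _).
  have := PA_ge0 i j; have := PB_ge0 i j; rewrite !mxE.
  by move=> hB hA; have [g0 g1] := andP g01; rewrite addr_ge0 // mulr_ge0 // subr_ge0.
rewrite -fcol1 PC_fcol //; congr fcol; apply: funext => eta; exact: opC_cst.
Qed.

Lemma mulmx_ge0 m n l (A : 'M[R]_(m, n)) (B : 'M[R]_(n, l)) :
  (forall i j, 0 <= A i j) -> (forall i j, 0 <= B i j) -> forall i j, 0 <= (A *m B) i j.
Proof. by move=> A0 B0 i j; rewrite mxE sumr_ge0 // => k _; rewrite mulr_ge0. Qed.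

Lemma expmx_ge0 n (A : 'M[R]_n) k :
  (forall i j, 0 <= A i j) -> forall i j, 0 <= (A ^+ k) i j.
Proof.
move=> A0; elim: k => [|k IHk]; first by move=> i j; rewrite expr0 mxE ler0n.
by rewrite exprS; apply: mulmx_ge0.
Qed.

Lemma pattern_stationary r s :
  is_stationary (PA' R N ^+ r *m PB N p ^+ s) (stationary (PA' R N ^+ r *m PB N p ^+ s)).
Proof.
apply: stationaryP; first exact: card_state_gt0.
  by apply: mulmx_ge0; apply: expmx_ge0 => i j; rewrite ?PA_ge0 ?PB_ge0.
rewrite -fcol1 pattern_fcol; congr fcol.
elim: (_ ++ _) => //= b w ->; apply: funext => eta.
by case: b; rewrite /op ?opA_cst ?opB_cst.
Qed.

(** The common property through which both chains are treated: the mixture generator is almost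
    centred under [nu] on local observables. *)
Definition near_stationary (B : R) : Prop :=
  forall k c f, local k c f ->
    `|expect nu (fun eta => opC p gamma f eta - f eta)| <= B * (k%:R ^+ 2 * c) / N%:R ^+ 2.

Lemma mix_near_stationary B : 0 <= B -> nu *m PC N p gamma = nu -> near_stationary B.
Proof.
move=> B0 nuP k c f fl; rewrite expectB -[expect nu (opC _ _ _)]expectE -PC_fcol //.
rewrite mulmxA nuP expectE subrr normr0 divr_ge0 ?exprn_ge0 // mulr_ge0 //.
by rewrite mulr_ge0 ?exprn_ge0 // (local_ge0 fl).
Qed.

(** The increments along the pattern add up to [r (A' - 1) + s (B - 1)], which is [r + s] times the
    mixture increment since [gamma = r / (r + s)]. Under [nu] the whole word has zero increment, so
    only the second-order remainder is left. *)
Lemma pattern_near_stationary r s : (0 < r + s)%N -> gamma = r%:R / (r + s)%:R ->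
  nu *m (PA' R N ^+ r *m PB N p ^+ s) = nu -> near_stationary ((r + s)%:R * 108).
Proof.
move=> rs0 gE nuP k c f fl.
have rsn : (r + s)%:R != 0 :> R by rewrite pnatr_eq0 -lt0n.
pose w := nseq r true ++ nseq s false.
have sw : size w = (r + s)%N by rewrite size_cat !size_nseq.
have fixw : expect nu (opw p w f) = expect nu f.
  by rewrite -!expectE -pattern_fcol mulmxA nuP.
pose rest eta := opw p w f eta - f eta - \sum_(b <- w) (op p b f eta - f eta).
have restE : rest = fun eta => opw p w f eta - f eta - (r + s)%:R * (opC p gamma f eta - f eta).
  apply: funext => eta; rewrite /rest big_cat /=; congr (_ - _).
  have nseqE n b : \sum_(d <- nseq n b) (op p d f eta - f eta) =
      n%:R * (op p b f eta - f eta).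
    by rewrite big_nseq iter_addr_0 mulr_natl.
  rewrite !nseqE /op /opC gE natrD; field.
  by rewrite -natrD.
have : `|expect nu rest| <= (r + s)%:R ^+ 2 * (108 * k%:R ^+ 2 * c / N%:R ^+ 2).
  by apply: expect_le => eta; rewrite -sw; apply: opw_second_order.
rewrite restE expectB expectB fixw subrr sub0r normrN expectZ normrM ger0_norm //.
rewrite expr2 -mulrA ler_pM2l ?ltr0n // => /le_trans; apply.
by rewrite le_eqVlt; apply/orP; left; apply/eqP; rewrite -!mulrA.
Qed.

End Expectation.

(** * The limit *)

Section Drift.
Variables (R : realType) (p : 4.-tuple R).
Hypothesis p01 : forall m : nat, (m < 4)%N -> 0 <= p`_m <= 1.

Lemma drift_local (N : nat) (x : 'I_N) : local 2 1 (fun eta : state N => drift p eta x).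
Proof.
exists [set ord_pred x; ordS x]%SET; split=> [|eta zeta ez|eta].
- by rewrite cards2; case: (_ != _).
- by rewrite /drift /nbr_code !ez // !inE eqxx ?orbT.
- by have := p_code01 p01 eta x; rewrite /drift ler_norml; lra.
Qed.

(** The mean drift depends on all sites, but by linearity it is an average of drifts of support 2
    and norm 1, each moving by at most [6 * 2 * 1 / N] per round. *)
Lemma opw_mean_drift_sub (N : nat) (w : seq bool) (eta : state N) : (2 < N)%N ->
  `|opw p w (mean_drift p (N := N)) eta - mean_drift p eta| <= (size w)%:R * (12 / N%:R).
Proof.
move=> N2.
have -> : opw p w (mean_drift p (N := N)) eta =
    N%:R^-1 * \sum_x opw p w (fun zeta => drift p zeta x) eta.
  elim: w eta => //= b w IHw eta.
  have -> : opw p w (mean_drift p (N := N)) =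
      fun zeta => N%:R^-1 * \sum_x opw p w (fun t => drift p t x) zeta.
    exact: funext.
  by rewrite opZ op_sum.
rewrite -mulrBr -sumrB; apply: avg_le => // x.
have := opw_sub_le N2 p01 w eta (drift_local x).
by rewrite (_ : 6 * 2 * 1 = 12) //; ring.
Qed.

(** Only the two neighbours of the centre matter: there the oscillation is at most 2 and the weight
    at least [rho]. *)
Lemma drift_center_osc (K : nat) (rho : R) : (0 < K)%N -> 0 < rho -> rho < 1 ->
  osc (fun eta : state K.*2.+1 => drift p eta (wcenter K))
      (fun y => 2 / rho * rho ^+ cdist y).
Proof.
move=> K0 rho0 rho1 eta y b.
have bound0 : 0 <= 2 / rho * rho ^+ cdist y.
  by rewrite mulr_ge0 ?divr_ge0 ?exprn_ge0 ?ltW.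
have c0 : cdist (wcenter K) = 0%N by rewrite /cdist wcenterE subnn.
have [y1|] := boolP ((y == ordS (wcenter K)) || (y == ord_pred (wcenter K))).
  have d1 : (cdist y <= 1)%N.
    case/orP: y1 => /eqP ->.
      by have [+ _] := cdist_ordS (wcenter K); rewrite c0.
    by have [_ +] := cdist_ordS (ord_pred (wcenter K)); rewrite ord_predK c0.
  apply: (@le_trans _ _ 2).
    have := p_code01 p01 eta (wcenter K); have := p_code01 p01 (upd eta y b) (wcenter K).
    by rewrite /drift ler_norml; lra.
  have r2 : 0 <= 2 / rho by rewrite divr_ge0 // ltW.
  rewrite -[X in X <= _](@divfK _ rho) ?gt_eqF // ler_wpM2l //.
  by rewrite -[X in X <= _]expr1 ler_wiXn2l // ltW.
rewrite negb_or => /andP[yS yP].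
rewrite /drift /nbr_code !upd_neq; first by rewrite subrr normr0.
  by rewrite eq_sym.
by rewrite eq_sym.
Qed.

Variables (gamma a c rho kappa : R).
Hypothesis g01 : 0 <= gamma <= 1.
Hypotheses (a01 : `|p`_0 - p`_1| <= a) (a23 : `|p`_2 - p`_3| <= a).
Hypotheses (c02 : `|p`_0 - p`_2| <= c) (c13 : `|p`_1 - p`_3| <= c).
Hypotheses (rho0 : 0 < rho) (rho1 : rho < 1) (kappa0 : 0 < kappa).
Hypothesis kappaE : kappa = 1 + gamma - (1 - gamma) * (a + c) / rho.

(** The factor 5 of the window comparison, times the two ends, times the amplitude [E / kappa] of
    the Poisson solution for [E = 2 / rho]. *)
Definition edge_const : R := 5 * (2 * (2 / rho / kappa)).

(** The constant [k] comes from the circle of length [2 K + 1], hence precedes [N] and [nu]: this is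
    what makes both chains share it. [H] absorbs the sup norm of the Poisson solution, for which no
    uniformity in [K] is claimed. *)
Lemma near_stationary_drift (K : nat) (B : R) : (0 < K)%N -> 0 <= B ->
  exists k H, 0 <= H /\ forall N (nu : 'rV[R]_#|state N|), (K.*2 < N)%N ->
    (forall j, 0 <= nu ord0 j) -> \sum_j nu ord0 j = 1 -> near_stationary p nu gamma B ->
    `|expect nu (mean_drift p (N := N)) - k| <= edge_const * rho ^+ K + H / N%:R.
Proof.
move=> K0 B0.
pose g := fun eta : state K.*2.+1 => drift p eta (wcenter K).
have [f [k fk]] := poisson_solvable K0 p01 g01 a01 a23 c02 c13 rho0 rho1 kappa0 kappaE g.
have fosc := poisson_osc K0 p01 g01 a01 a23 c02 c13 rho0 rho1 kappa0 kappaE fk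
  (drift_center_osc K0 rho0 rho1).
pose L := \sum_eta `|f eta|.
have fL eta : `|f eta| <= L by rewrite /L (bigD1 eta) //= lerDl sumr_ge0.
have L0 : 0 <= L by rewrite sumr_ge0.
exists k, (B * (K.*2.+1%:R ^+ 2 * L)); split.
  by rewrite mulr_ge0 // mulr_ge0 // exprn_ge0.
move=> N nu MN nu0 nu1 nuB.
have N2 : (2 < N)%N by clear -K0 MN; lia.
have Nn0 : 0 < N%:R :> R by rewrite ltr0n (leq_ltn_trans _ MN).
have site x : `|expect nu (fun eta => drift p eta x) - k| <=
    edge_const * rho ^+ K + B * (K.*2.+1%:R ^+ 2 * L) / N%:R.
  pose F := fun eta : state N => f (window K x eta).
  have Floc : local K.*2.+1 L F.
    exists [set wpos x j | j : 'I_K.*2.+1]%SET; split=> [|eta zeta ez|eta]; last exact: fL.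
      by rewrite (leq_trans (leq_imset_card _ _)) // card_ord.
    by congr f; apply/ffunP => j; rewrite !ffunE ez // imset_f.
  (* Defect in the long circle of the Poisson equation solved in the short one; it comes from the
     ends of the window only. *)
  pose err eta := N%:R * (opC p gamma F eta - F eta) - (k - drift p eta x).
  have errP eta : `|err eta| <= edge_const * rho ^+ K.
    have := window_opC K0 MN x fosc p01 g01 eta; rewrite -/F.
    have -> : K.*2.+1%:R * (opC p gamma f (window K x eta) - f (window K x eta)) =
        k - drift p eta x.
      have [d0 dm] := cdist_ends K.
      have wc_end (y : 'I_K.*2.+1) : cdist y = K -> wcenter K != y.
        by move=> yK; apply: contraTneq K0 => wy; rewrite -yK -wy /cdist wcenterE subnn.
      have := fk (window K x eta); rewrite /g /drift.
      rewrite nbr_code_window ?wpos_center ?wc_end // => fkx.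
      by rewrite -[RHS]opprB -fkx -mulrN opprB.
    have [-> ->] := cdist_ends K.
    move/le_trans; apply; rewrite /edge_const le_eqVlt; apply/orP; left; apply/eqP.
    by clear; ring.
  pose dx := fun eta : state N => drift p eta x.
  have errE : expect nu err =
      N%:R * expect nu (fun eta => opC p gamma F eta - F eta) - (k - expect nu dx).
    rewrite -expectZ -[k in RHS](expect_cst nu1) -!(expectB nu (fun=> k) dx).
    by rewrite -expectB.
  have -> : expect nu dx - k =
      expect nu err - N%:R * expect nu (fun eta => opC p gamma F eta - F eta).
    by rewrite errE; clear; ring.
  rewrite (le_trans (ler_normB _ _)) // lerD ?expect_le //.
  (* The generator carries a factor [N], which reduces the near-stationarity bound from order
     [1 / N ^ 2] to [1 / N]. *)
  rewrite normrM (ger0_norm (ltW Nn0)) -ler_pdivlMl // (le_trans (nuB _ _ _ Floc)) //.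
  by rewrite expr2 invfM mulrCA.
have -> : expect nu (mean_drift p (N := N)) - k =
    N%:R^-1 * \sum_x (expect nu (fun eta => drift p eta x) - k).
  rewrite sumrB sumr_const card_ord mulrBr -[k *+ _]mulr_natl mulKf ?gt_eqF //.
  congr (_ - _); rewrite /mean_drift expectZ; congr (_ * _).
  rewrite /expect exchange_big; apply: eq_bigr => i _ /=.
  by rewrite mulr_sumr.
exact: avg_le.
Qed.

End Drift.

(** The constant may vary with [e]: this gives the Cauchy property without knowing the limit, and
    the common constant forces equal limits. *)
Lemma near_const_cvg (R : realType) (u v : nat -> R) :
  (forall e : R, 0 < e -> exists k, exists N0, forall N, (N0 <= N)%N ->
     `|u N - k| <= e /\ `|v N - k| <= e) ->
  exists l : R, u N @[N --> \oo] --> l /\ v N @[N --> \oo] --> l.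
Proof.
move=> uv.
have cu : cvg (u N @[N --> \oo]).
  apply: cauchy_cvg; apply: cauchy_exP => e e0.
  have [k [N0 kP]] := uv (e / 2) (divr_gt0 e0 (ltr0Sn R 1)).
  exists k; exists N0 => // N /= /kP[uk _].
  by rewrite /ball /= distrC (le_lt_trans uk) // ltr_pdivrMr // ltr_pMr // ltr1n.
exists (lim (u N @[N --> \oo])); split=> //.
apply/cvgrPdist_le => e e0.
have e3 : 0 < e / 3 by rewrite divr_gt0.
have [k [N0 kP]] := uv _ e3.
near=> N.
have [uk vk] : `|u N - k| <= e / 3 /\ `|v N - k| <= e / 3.
  by apply: kP; near: N; apply: nbhs_infty_ge.
have lu : `|lim (u N @[N --> \oo]) - u N| <= e / 3.
  by near: N; move/cvgrPdist_le: cu; apply.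
move: uk vk lu; rewrite !ler_norml; lra.
Unshelve. all: by end_near.
Qed.

Lemma mu_mixE (R : realType) (gamma : R) (p : 4.-tuple R) (N : nat) :
  mu_mix gamma p N = (1 - gamma) * expect (stationary (PC N p gamma)) (mean_drift p (N := N)).
Proof. by rewrite /mu_mix -mulmxA PBdot_fcol1 expectE. Qed.

Lemma mu_patE (R : realType) (r s : nat) (p : 4.-tuple R) (N : nat) : (2 < N)%N ->
  mu_pat r s p N = (r + s)%:R^-1 * \sum_(0 <= v < s)
    expect (stationary (PA' R N ^+ r *m PB N p ^+ s))
      (opw p (nseq r true ++ nseq v false) (mean_drift p (N := N))).
Proof.
move=> N2; rewrite /mu_pat; congr (_ * _); apply: eq_bigr => v _.
by rewrite -(mulmxA _ (PBdot _ _)) PBdot_fcol1 -expectE -pattern_fcol // !mulmxA.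
Qed.

Lemma contraction_rate (R : realType) (gamma a c : R) :
  0 <= gamma <= 1 -> 0 <= a -> 0 <= c -> (1 - gamma) * (a + c) < 1 + gamma ->
  exists rho, [/\ 0 < rho, rho < 1 & 0 < 1 + gamma - (1 - gamma) * (a + c) / rho].
Proof.
move=> /andP[g0 g1] a0 c0; set t := _ * _ => tg.
have t0 : 0 <= t by rewrite mulr_ge0 ?subr_ge0 // addr_ge0.
(* The midpoint between the critical ratio [t / (1 + gamma)] and 1. *)
exists ((1 + gamma + t) / (2 * (1 + gamma))); split.
- by rewrite divr_gt0 //; lra.
- by rewrite ltr_pdivrMr; lra.
- rewrite subr_gt0 ltr_pdivrMr ?divr_gt0 //; try lra.
  rewrite (_ : (1 + gamma) * _ = (1 + gamma + t) / 2); first lra.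
  by field; lra.
Qed.

(** Each of the [s] rounds of game B is seen from [pi] after fewer than [r + s] rounds, each of
    which changes the mean drift by at most [12 / N]. *)
Lemma mu_pat_close (R : realType) (r s : nat) (p : 4.-tuple R) (N : nat) (k : R) :
  (2 < N)%N -> (forall m : nat, (m < 4)%N -> 0 <= p`_m <= 1) -> (0 < r + s)%N ->
  let pi := stationary (PA' R N ^+ r *m PB N p ^+ s) in
  `|mu_pat r s p N - s%:R / (r + s)%:R * k| <=
  `|expect pi (mean_drift p (N := N)) - k| + (12 * (r + s)%:R) / N%:R.
Proof.
move=> N2 p01 rs0; set pi := stationary _ => /=.
have [pi0 pi1 _] := pattern_stationary N2 p01 r s.
rewrite -/pi in pi0 pi1; set D := (X in _ <= X).
have D0 : 0 <= D by rewrite addr_ge0 // divr_ge0 // mulr_ge0.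
have term v : (v < s)%N ->
    `|expect pi (opw p (nseq r true ++ nseq v false) (mean_drift p (N := N))) - k| <= D.
  move=> vs; rewrite (le_trans (ler_distD (expect pi (mean_drift p (N := N))) _ _)) //.
  rewrite addrC lerD2l -expectB; apply: expect_le => // eta.
  apply: (le_trans (opw_mean_drift_sub p01 _ _ N2)).
  rewrite mulrA ler_wpM2r ?invr_ge0 // [12 * _]mulrC ler_wpM2r // ler_nat.
  by rewrite size_cat !size_nseq leq_add2l ltnW.
have rsn : 0 < (r + s)%:R :> R by rewrite ltr0n.
rewrite mu_patE // -/pi [s%:R / _]mulrC -mulrA -mulrBr mulr_natl.
have -> : k *+ s = \sum_(0 <= v < s) k by rewrite sumr_const_nat subn0.
rewrite -sumrB normrM ger0_norm ?invr_ge0 ?ler0n // ler_pdivrMl //.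
rewrite (le_trans (ler_norm_sum _ _ _)) // big_mkord.
apply: (@le_trans _ _ (\sum_(v < s) D)); first by apply: ler_sum => v _; apply: term.
by rewrite sumr_const card_ord -[X in X <= _]mulr_natl ler_wpM2r // ler_nat leq_addl.
Qed.

Lemma eventually_small (R : realType) (H e : R) : 0 <= H -> 0 < e ->
  exists N0, forall N, (N0 <= N)%N -> H / N%:R <= e.
Proof.
move=> H0 e0; exists (Num.bound (H / e)) => N NN.
have He : H / e < N%:R.
  by apply: lt_le_trans (archi_boundP _) _; rewrite ?ler_nat // divr_ge0 // ltW.
have N0 : 0 < N%:R :> R by apply: le_lt_trans He; rewrite divr_ge0 // ltW.
by rewrite ler_pdivrMr // mulrC -ler_pdivrMr // ltW.
Qed.

Lemma geometric_small (R : realType) (C rho e : R) : 0 < rho -> rho < 1 -> 0 < e ->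
  exists2 K, (0 < K)%N & C * rho ^+ K <= e.
Proof.
move=> rho0 rho1 e0.
have : `|rho| < 1 by rewrite ger0_norm // ltW.
move=> /(@cvg_geometric R C)/cvgrPdist_le/(_ _ e0)[K _ KP].
exists K.+1 => //; have /= := KP K.+1 (leqnSn K).
by rewrite sub0r normrN; apply: le_trans; apply: ler_norm.
Qed.

Theorem theorem14 (R : realType) (r s : nat) (hr : (1 <= r)%N) (hs : (1 <= s)%N)
    (gamma : R) (hgamma : gamma = r%:R / (r + s)%:R)
    (p : 4.-tuple R)
    (hp01 : forall m : nat, (m < 4)%N -> 0 <= p`_m <= 1)
    (hp : (forall m : nat, m \in [:: 0; 1; 2]%N -> 0 < p`_m < 1) \/
          (forall m : nat, m \in [:: 1; 2; 3]%N -> 0 < p`_m < 1))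
    (hmax :
      Num.max `|gamma / 2 + (1 - gamma) * (p`_0 - p`_1)|
              `|gamma / 2 + (1 - gamma) * (p`_2 - p`_3)|
      + Num.max `|gamma / 2 + (1 - gamma) * (p`_0 - p`_2)|
                `|gamma / 2 + (1 - gamma) * (p`_1 - p`_3)| < 1) :
  exists l : R,
    mu_mix gamma p N @[N --> \oo] --> l /\
    mu_pat r s p N @[N --> \oo] --> l.
Proof.
have rs0 : 0 < (r + s)%:R :> R by rewrite ltr0n; lia.
have g01 : 0 <= gamma <= 1.
  by rewrite hgamma divr_ge0 //= ler_pdivrMr // mul1r ler_nat leq_addr.
have [g0 g1] := andP g01.
have g1s : 1 - gamma = s%:R / (r + s)%:R.
  by rewrite hgamma -{1}(divff (lt0r_neq0 rs0)) -mulrBl natrD addrC addKr.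
pose a := Num.max `|p`_0 - p`_1| `|p`_2 - p`_3|.
pose c := Num.max `|p`_0 - p`_2| `|p`_1 - p`_3|.
have [a01 a23] : `|p`_0 - p`_1| <= a /\ `|p`_2 - p`_3| <= a.
  by rewrite /a !le_max !lexx orbT.
have [c02 c13] : `|p`_0 - p`_2| <= c /\ `|p`_1 - p`_3| <= c.
  by rewrite /c !le_max !lexx orbT.
(* Removing the shift [gamma / 2] costs [gamma / 2] in each maximum, so the hypothesis yields the
   bound [1 + gamma] on [(1 - gamma) * (a + c)]. *)
have max_sub (d d' : R) : (1 - gamma) * Num.max `|d| `|d'| <=
    Num.max `|gamma / 2 + (1 - gamma) * d| `|gamma / 2 + (1 - gamma) * d'| + gamma / 2.
  have one e : (1 - gamma) * `|e| <= `|gamma / 2 + (1 - gamma) * e| + gamma / 2.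
    have g1' : 0 <= 1 - gamma by lra.
    rewrite -{1}(ger0_norm g1') -normrM.
    rewrite [X in `|X| <= _](_ : _ = (gamma / 2 + (1 - gamma) * e) - gamma / 2).
      by rewrite (le_trans (ler_normB _ _)) // lerD2l ger0_norm // divr_ge0.
    by rewrite addrAC subrr add0r.
  have := one d; have := one d'; set m := Num.max `|gamma / 2 + _| _.
  have : `|gamma / 2 + (1 - gamma) * d| <= m by rewrite /m le_max lexx.
  have : `|gamma / 2 + (1 - gamma) * d'| <= m by rewrite /m le_max lexx orbT.
  by case: (leP `|d| `|d'|) => _; lra.
have ac : (1 - gamma) * (a + c) < 1 + gamma.
  have := max_sub (p`_0 - p`_1) (p`_2 - p`_3).
  by have := max_sub (p`_0 - p`_2) (p`_1 - p`_3); rewrite -/a -/c; lra.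
have [rho [rho0 rho1 kappa0]] :=
  contraction_rate g01 (a_ge0 a01) (c_ge0 c02) ac.
set kappa := _ - _ in kappa0.
have main := near_stationary_drift hp01 g01 a01 a23 c02 c13 rho0 rho1 kappa0 erefl.
pose B : R := (r + s)%:R * 108.
have B0 : 0 <= B by rewrite mulr_ge0.
apply: near_const_cvg => e e0.
have e3 : 0 < e / 3 by rewrite divr_gt0.
(* Order of choices: [K] makes the window error small, which fixes [k] and [H]; then [N] is taken
   large. *)
have [K K0 rhoK] := geometric_small (edge_const rho kappa) rho0 rho1 e3.
have [k [H [H0 kP]]] := main K B K0 B0.
have [N1 N1P] := eventually_small H0 e3.
have [N2 N2P] : exists N0, forall N, (N0 <= N)%N -> (12 * (r + s)%:R) / N%:R <= e / 3.
  by apply: eventually_small => //; rewrite mulr_ge0.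
(* One constant suits both means, since game B has weight [1 - gamma = s / (r + s)] in each. *)
exists ((1 - gamma) * k), (K.*2.+1 + (N1 + N2))%N => N NN.
have NK : (K.*2 < N)%N by apply: leq_trans NN; rewrite leq_addr.
have gt2 : (2 < N)%N by clear -K0 NK; lia.
have {}N1P : H / N%:R <= e / 3.
  by apply: N1P; apply: leq_trans NN; rewrite addnCA leq_addr.
have {}N2P : (12 * (r + s)%:R) / N%:R <= e / 3.
  by apply: N2P; apply: leq_trans NN; rewrite addnA leq_addl.
split.
  have [nu0 nu1 nuP] := mix_stationary gt2 hp01 g01.
  have := kP N _ NK nu0 nu1 (mix_near_stationary gt2 B0 nuP).
  rewrite mu_mixE -mulrBr normrM ger0_norm ?subr_ge0 //; set d := `| _ | => dP.
  have d0 : 0 <= d by apply: normr_ge0.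
  by have := mulr_ge0 g0 d0; clear -dP rhoK N1P e0; lra.
have [nu0 nu1 nuP] := pattern_stationary gt2 hp01 r s.
have rsn : (0 < r + s)%N by rewrite addn_gt0 hr.
have := kP N _ NK nu0 nu1 (pattern_near_stationary gt2 hp01 nu0 nu1 rsn hgamma nuP).
have := mu_pat_close k gt2 hp01 rsn; rewrite -g1s /=; lra.
Qed.
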